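(* Let $\gamma\subset\mathbb{R}^2$ be a closed convex curve (no smoothness is assumed) and let $Q$ be a rectangle. Then $Q$ can be inscribed in $\gamma$, i.e. there is a map $\phi:\mathbb{R}^2\to\mathbb{R}^2$ which is a composition of a non-degenerate scaling, a rotation and a translation such that $\phi$ maps all four vertices of $Q$ to points of $\gamma$.
   Context: A closed convex curve is the boundary of a compact convex subset of the plane with nonempty interior. Rectangles are non-degenerate (both side lengths positive). To inscribe a quadrilateral $Q$ in a Jordan curve is to find a non-degenerate scaling (by a factor $\lambda>0$), rotation, and translation whose composition maps all of the vertices of $Q$ to the curve. *)

(* Defs.v *)
From HB Require Import structures.
From mathcomp Require Import all_boot all_order all_algebra.
From mathcomp Require Import all_classical all_reals all_analysis.

Set Implicit Arguments.
Unset Strict Implicit.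
Unset Printing Implicit Defensive.

Import Order.TTheory GRing.Theory Num.Theory.
Import numFieldNormedType.Exports.

Local Open Scope classical_set_scope.
Local Open Scope ring_scope.

(* The norm of the library on 'rV[R]_2 is the sup norm. It is used only through
   its topology, which is the Euclidean one; orthogonality is expressed with
   [dot] below. *)
Notation plane R := 'rV[R]_2.

Definition dot (R : realType) (u v : plane R) : R := (u *m v^T) 0 0.

Definition boundary (T : topologicalType) (A : set T) : set T :=
  closure A `\` interior A.

Definition closed_convex_curve (R : realType) (gamma : set (plane R)) : Prop :=
  exists K : set (plane R),
    [/\ compact K, convex_set (K : set (convex_lmodType (plane R))),
        interior K !=set0 & gamma = boundary K].

(* A quadrilateral is given by its vertices in cyclic order; addition on 'I_4
   is modulo 4. *)
Definition quadrilateral (R : realType) := 'I_4 -> plane R.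

Definition side (R : realType) (Q : quadrilateral R) (i : 'I_4) : plane R :=
  Q (i + 1) - Q i.

(* All sides have positive length and all four angles are right. *)
Definition rectangle (R : realType) (Q : quadrilateral R) : Prop :=
  forall i : 'I_4, side Q i != 0 /\ dot (side Q i) (side Q (i + 1)) = 0.

Definition scaling (R : realType) (lambda : R) (v : plane R) : plane R :=
  lambda *: v.

Definition rotation (R : realType) (theta : R) (v : plane R) : plane R :=
  \row_(j < 2) if j == 0 then cos theta * v 0 0 - sin theta * v 0 1
               else sin theta * v 0 0 + cos theta * v 0 1.

Definition translation (R : realType) (t v : plane R) : plane R := v + t.

(* Since scalings and rotations about the origin commute with each other and
   normalize the translations, the order of composition is immaterial. *)
Definition similarity (R : realType) (phi : plane R -> plane R) : Prop :=
  exists (lambda theta : R) (t : plane R),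
    0 < lambda /\ phi = translation t \o rotation theta \o scaling lambda.

Definition inscribed_by (R : realType) (phi : plane R -> plane R)
    (Q : quadrilateral R) (gamma : set (plane R)) : Prop :=
  similarity phi /\ forall i : 'I_4, gamma (phi (Q i)).

(* Main.v *)
Require Import Defs.
From mathcomp Require Import all_boot all_order all_algebra.
From mathcomp Require Import all_classical all_reals all_analysis.
From mathcomp Require Import ring lra.

(* A rectangle is a pair of chords of equal length bisecting each other at a
   prescribed angle [al]. Allow first two chords of different half-lengths [a]
   and [b], in the directions [t] and [t + al], bisecting each other at [c].
   Such a parallelogram exists for every [t] (intermediate value theorem along
   the midpoints of the chords of direction [t + al]). If the gauge is made
   strongly convex, it is unique and depends on [t] in a Lipschitz way. Let
   [Phi t] be twice the area of the two opposite sectors of the convex body cut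
   out by the chords. Because the chords are bisected at [c], the motion of [c]
   does not contribute to first order, so [Phi' = 2 (b ^ 2 - a ^ 2)]; and
   [Phi pi = Phi 0] since turning by [pi] only exchanges opposite vertices.
   Rolle's theorem gives [a = b]. The strong convexity is removed by a limit,
   which does not degenerate: an inscribed parallelogram has diagonals bounded
   below in terms of the inradius. *)

Set Implicit Arguments.
Unset Strict Implicit.
Unset Printing Implicit Defensive.

Import Order.TTheory GRing.Theory Num.Theory.
Import numFieldNormedType.Exports.

Local Open Scope classical_set_scope.
Local Open Scope ring_scope.

(** * Strongly convex functions of two variables *)

(** Nothing is assumed about tangents, so the implicit function theorem cannot control the
    parallelogram as [t] varies. Instead, two parallelograms in the same frame are compared:
    convexity bounds the shift of the center along one diagonal, up to the change of half-length, by
    the shift along the other. For a merely convex body the two bounds close up circularly with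
    factor 1; strong convexity lowers it to some [k < 1], and the system can be solved. The
    Lipschitz bound suffices to differentiate [Phi], since products of two increments are then of
    second order and the boundary enters only through the continuous function [radial]. The sectors
    are swept from the origin of the gauge, not from the moving center [c]. The total area is the
    same: the correction is the cross product of [c] with the difference of the two sums of opposite
    vertices, and both sums equal [2 c]. Strong convexity comes from adding [e * (x ^ 2 + y ^ 2)] to
    the Minkowski gauge. The estimates are made in coordinates along the two chord directions, where
    the diagonals are parallel to the axes. *)

Record strong_convex (R : realType) (e L D : R) (H : R -> R -> R) : Prop :=
  StrongConvex {
    sc_e : 0 < e;
    sc_conv : forall t x y x' y', 0 <= t -> t <= 1 ->
      H ((1 - t) * x + t * x') ((1 - t) * y + t * y') <=
      (1 - t) * H x y + t * H x' y' - e * t * (1 - t) * ((x - x') ^+ 2 + (y - y') ^+ 2);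
    sc_lip : forall x y x' y', H x y - H x' y' <=
      L * (1 + `|x| + `|y| + `|x'| + `|y'|) * (`|x - x'| + `|y - y'|);
    sc_0 : H 0 0 = 0;
    sc_bnd : forall x y, H x y <= 1 -> `|x| <= D /\ `|y| <= D }.

(** Two applications of [sc_conv], first to points 1 and 2, then with point 3. The losses add up
    exactly to the pairwise form: the squared distance from point 3 to the intermediate point is the
    weighted mean of those to points 1 and 2, minus [t * (1 - t)] times the squared distance between
    these. *)
Lemma strong_convex3 (R : realType) (e L D : R) H (h : strong_convex e L D H)
  (l m n x1 y1 x2 y2 x3 y3 x y : R) :
  0 <= l -> 0 <= m -> 0 <= n -> l + m + n = 1 ->
  x = l * x1 + m * x2 + n * x3 -> y = l * y1 + m * y2 + n * y3 ->
  H x y <= l * H x1 y1 + m * H x2 y2 + n * H x3 y3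
     - e * (l * m * ((x1 - x2) ^+ 2 + (y1 - y2) ^+ 2)
          + l * n * ((x1 - x3) ^+ 2 + (y1 - y3) ^+ 2)
          + m * n * ((x2 - x3) ^+ 2 + (y2 - y3) ^+ 2)).
Proof.
move=> l0 m0 n0 s1 -> ->.
have [n1|n1] := eqVneq n 1.
  have [-> ->] : l = 0 /\ m = 0 by split; lra.
  by rewrite n1 !mul0r !add0r !mul1r mulr0 subr0.
have k0 : 0 < l + m.
  have : n <= 1 by lra.
  by rewrite le_eqVlt (negbTE n1) /= => ?; lra.
have [t [k [t0 t1 kp k1 [-> -> ->]]]] : exists t k, [/\ 0 <= t, t <= 1, 0 < k, k <= 1 & [/\ l =
  (1 - t) * k, m = t * k & n = 1 - k]].
  exists (m / (l + m)), (l + m).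
  have mE : m / (l + m) * (l + m) = m by rewrite divfK // gt_eqF.
  split => //; [by rewrite divr_ge0 // ltW | by rewrite ler_pdivrMr //; lra | lra |].
  by rewrite mulrBl mE mul1r; split; lra.
have A := sc_conv h x1 y1 x2 y2 t0 t1.
set X := (1 - t) * x1 + t * x2 in A.
set Y := (1 - t) * y1 + t * y2 in A.
have B := sc_conv h X Y x3 y3 (ltac:(lra) : 0 <= 1 - k) (ltac:(lra) : 1 - k <= 1).
have -> : (1 - t) * k * x1 + t * k * x2 + (1 - k) * x3 = (1 - (1 - k)) * X + (1 - k) * x3.
  by rewrite /X; ring.
have -> : (1 - t) * k * y1 + t * k * y2 + (1 - k) * y3 = (1 - (1 - k)) * Y + (1 - k) * y3.
  by rewrite /Y; ring.
apply: (le_trans B).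
have := ler_wpM2l (ltW kp) A; rewrite /X /Y.
move: (H _ _) (H _ _) (H _ _) (H _ _) => a b c d A'; nra.
Qed.


Lemma convex3_lt1 (R : realType) (e L D : R) H (h : strong_convex e L D H)
  (l m n x1 y1 x2 y2 x3 y3 x y : R) :
  0 < l -> 0 <= m -> 0 <= n -> l + m + n = 1 ->
  H x1 y1 < 1 -> H x2 y2 <= 1 -> H x3 y3 <= 1 ->
  x = l * x1 + m * x2 + n * x3 -> y = l * y1 + m * y2 + n * y3 -> H x y < 1.
Proof.
move=> l0 m0 n0 s1 h1 h2 h3 xE yE.
apply: (le_lt_trans (strong_convex3 h (ltW l0) m0 n0 s1 xE yE)).
have e0 := sc_e h.
set q := e * _.
have q0 : 0 <= q.
  rewrite /q mulr_ge0 ?(ltW e0) // !addr_ge0 // mulr_ge0 ?mulr_ge0 ?(ltW l0) // addr_ge0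
    ?sqr_ge0 //.
have : l * H x1 y1 < l by rewrite gtr_pMr.
have : m * H x2 y2 <= m by rewrite ler_piMr.
have : n * H x3 y3 <= n by rewrite ler_piMr.
lra.
Qed.

Lemma convex2_lt1 (R : realType) (e L D : R) H (h : strong_convex e L D H)
  (t x1 y1 x2 y2 x y : R) :
  0 <= t -> t < 1 -> H x1 y1 < 1 -> H x2 y2 <= 1 ->
  x = (1 - t) * x1 + t * x2 -> y = (1 - t) * y1 + t * y2 -> H x y < 1.
Proof.
move=> t0 t1 h1 h2 -> ->.
apply: (convex3_lt1 h (l := 1 - t) (m := t) (n := 0) _ t0 _ _ h1 h2 h2); lra.
Qed.

Lemma strong_convex_swap (R : realType) (e L D : R) H :
  strong_convex e L D H -> strong_convex e L D (fun x y => H y x).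
Proof.
move=> h; split; first exact: sc_e h.
- move=> t x y x' y' t0 t1; rewrite (addrC ((x - _) ^+ 2)); exact: (sc_conv h).
- move=> x y x' y'; apply: (le_trans (sc_lip h _ _ _ _)).
  by rewrite le_eqVlt; apply/orP; left; apply/eqP; ring.
- exact: sc_0 h.
- by move=> x y /(sc_bnd h) [].
Qed.

Lemma strong_convex_flip (R : realType) (e L D : R) H :
  strong_convex e L D H -> strong_convex e L D (fun x y => H (- x) y).
Proof.
move=> h; split; first exact: sc_e h.
- move=> t x y x' y' t0 t1.
  have -> : - ((1 - t) * x + t * x') = (1 - t) * (- x) + t * (- x') by ring.
  have -> : (x - x') ^+ 2 = (- x - - x') ^+ 2 by ring.
  exact: (sc_conv h).
- move=> x y x' y'; apply: (le_trans (sc_lip h _ _ _ _)).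
  by rewrite !normrN -opprD normrN.
- by rewrite oppr0; exact: sc_0 h.
- by move=> x y /(sc_bnd h) []; rewrite normrN.
Qed.

(* Read with [K = {H <= 1}]: otherwise [(x + a, y)] would lie in the interior of
   the triangle spanned by [(x + X, y + Y)], [(x, y - b)] and [(x, y)]. *)
Lemma chord_end_ge0 (R : realType) (e L D : R) H (h : strong_convex e L D H)
  (x y a b X Y : R) :
  0 < a -> 0 < b -> 0 <= Y -> H x y <= 1 -> H x (y - b) <= 1 -> 1 <= H (x + a) y ->
  H (x + X) (y + Y) < 1 -> X * b <= a * b + a * Y.
Proof.
move=> a0 b0 Y0 hc hB hR ho; rewrite leNgt; apply/negP => lt.
have X0 : 0 < X.
  rewrite -(pmulr_lgt0 _ b0); apply: le_lt_trans lt.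
  by rewrite addr_ge0 // mulr_ge0 // ltW.
have bX0 : 0 < b * X by rewrite mulr_gt0.
have bN0 : b != 0 by rewrite gt_eqF.
have XN0 : X != 0 by rewrite gt_eqF.
have := @convex3_lt1 _ _ _ _ _ h (a / X) (a * Y / (b * X)) (1 - a / X - a * Y / (b * X))
  _ _ _ _ _ _ (x + a) y _ _ _ _ ho hB hc.
have l0 : 0 < a / X by rewrite divr_gt0.
have m0 : 0 <= a * Y / (b * X) by rewrite divr_ge0 ?mulr_ge0 // ltW.
have n0 : 0 <= 1 - a / X - a * Y / (b * X).
  have -> : 1 - a / X - a * Y / (b * X) = (X * b - (a * b + a * Y)) / (b * X).
    by field; rewrite ?bN0 ?XN0.
  by rewrite divr_ge0 ?(ltW bX0) // subr_ge0 ltW.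
move=> /(_ l0 m0 n0) H1.
suff : H (x + a) y < 1 by lra.
apply: H1; first by ring.
- by field; rewrite ?bN0 ?XN0.
- by field; rewrite ?bN0 ?XN0.
Qed.

Lemma chord_end (R : realType) (e L D : R) H (h : strong_convex e L D H)
  (x y a b X Y : R) :
  0 < a -> 0 < b -> H x y <= 1 -> H x (y - b) <= 1 -> H x (y + b) <= 1 -> 1 <= H (x + a) y ->
  H (x + X) (y + Y) < 1 -> X * b <= a * b + a * `|Y|.
Proof.
move=> a0 b0 hc hB hT hR ho.
have [Y0|Y0] := ger0P Y; first exact: (chord_end_ge0 h a0 b0 Y0 hc hB hR ho).
have h' := strong_convex_swap (strong_convex_flip (strong_convex_swap h)).
apply: (chord_end_ge0 h' (x := x) (y := - y)) => //.
- lra.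
- by rewrite opprK.
- by rewrite opprB opprK addrC.
- by rewrite opprK.
- by rewrite opprD !opprK.
Qed.

(** The chords cannot be short because both [(rho, 0)] and the origin are interior. [A] compares the
    right end with [(rho, 0)], [B] compares an end of the vertical chord with the origin, and [C]
    carries [B] over from [l] to [r <= l]. In the sum of [A] and [C] the terms with [x] cancel. *)
Lemma half_chord_ge (R : realType) (e L D : R) H (h : strong_convex e L D H)
  (x y r l b rho : R) :
  0 < r -> r <= l -> 0 < b -> H x y <= 1 -> H x (y - b) = 1 -> H x (y + b) = 1 ->
  H (x + r) y = 1 -> H (x - l) y = 1 -> x <= 0 -> H rho 0 < 1 -> rho <= 2 * r.
Proof.
move=> r0 rl b0 hc hB hT hR hL x0 hrho.
have l0 := lt_le_trans r0 rl.
have A : (rho - x) * b <= r * b + r * `|- y|.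
  apply: (chord_end h r0 b0 hc) => //; rewrite ?hB ?hT ?hR //.
  by rewrite addrC subrK subrr.
have B : `|- y| * l <= b * l + b * - x.
  have x0' : 0 <= - x by lra.
  have [y0|y0] := ger0P (- y).
    apply: (chord_end_ge0 (strong_convex_swap h) (x := y) (y := x)) => //; rewrite ?hT ?hL //.
    by rewrite !subrr (sc_0 h) ltr01.
  apply: (chord_end_ge0 (strong_convex_flip (strong_convex_swap h)) (x := - y) (y := x)) => //.
  - by rewrite opprK.
  - by rewrite opprK hL.
  - by rewrite opprD opprK hB.
  - by rewrite !subrr oppr0 (sc_0 h) ltr01.
rewrite normrN in A B.
have C : r * `|y| <= b * r + b * - x.
  have : r * (`|y| * l) <= r * (b * l + b * - x) by rewrite ler_pM2l.
  have : b * - x * r <= b * - x * l by rewrite ler_wpM2l // mulr_ge0; lra.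
  move=> p q; rewrite -(ler_pM2r l0).
  by move: p q; nra.
suff : rho * b <= 2 * r * b by rewrite ler_pM2r.
by move: A C; nra.
Qed.

(** * Exit times of rays *)

Lemma strong_convex_cvg (R : realType) (e L D : R) H (h : strong_convex e L D H)
  (T : Type) (F : set_system T) {FF : Filter F} (f g : T -> R) (a b : R) :
  f x @[x --> F] --> a -> g x @[x --> F] --> b -> H (f x) (g x) @[x --> F] --> H a b.
Proof.
move=> fa gb; apply/subr_cvg0.
pose w x := L * (1 + `|f x| + `|g x| + `|a| + `|b|) * (`|f x - a| + `|g x - b|).
have wE x y x' y' : L * (1 + `|x| + `|y| + `|x'| + `|y'|) * (`|x - x'| + `|y - y'|) =
  L * (1 + `|x'| + `|y'| + `|x| + `|y|) * (`|x' - x| + `|y' - y|).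
  by rewrite (distrC x') (distrC y'); ring.
have w0 : w x @[x --> F] --> 0.
  have -> : 0 = L * (1 + `|a| + `|b| + `|a| + `|b|) * (`|a - a| + `|b - b|) :> R.
    by rewrite !subrr normr0 addr0 mulr0.
  by rewrite /w; do ?[exact: cvg_cst | exact: fa | exact: gb | apply: cvgD | apply: cvgM |
    apply: cvg_norm | apply: cvgB].
apply: (@squeeze_cvgr _ _ _ _ (fun x => - w x) w).
- apply: nearW => x; rewrite (sc_lip h) andbT lerNl opprB /w wE; exact: (sc_lip h).
- by rewrite -oppr0; apply: cvgN.
- exact: w0.
Qed.

(** This makes the exit time of a ray from an interior point unique and stable. *)
Lemma above_chord (R : realType) (e L D : R) H (h : strong_convex e L D H)
  (x y u v s t : R) : 0 <= s -> s < t -> H x y < 1 ->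
  (H (x + t * u) (y + t * v) <= 1 -> H (x + s * u) (y + s * v) < 1) /\
  (H (x + s * u) (y + s * v) = 1 -> 1 < H (x + t * u) (y + t * v)).
Proof.
move=> s0 st hc.
have t0 : 0 < t by lra.
have A : H (x + t * u) (y + t * v) <= 1 -> H (x + s * u) (y + s * v) < 1.
  move=> ht; apply: (convex2_lt1 h (t := s / t) _ _ hc ht).
  - by rewrite divr_ge0 // ltW.
  - by rewrite ltr_pdivrMr // mul1r.
  - by field; rewrite gt_eqF.
  - by field; rewrite gt_eqF.
split=> // hs; rewrite ltNge; apply/negP => /A; lra.
Qed.

Lemma exit_exists (R : realType) (e L D : R) H (h : strong_convex e L D H)
  (x y u v : R) : H x y < 1 -> 0 < `|u| + `|v| ->
  exists2 t, 0 < t & H (x + t * u) (y + t * v) = 1.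
Proof.
move=> hc uv.
have [t [t0 ht]] : exists t, 0 < t /\ 1 < H (x + t * u) (y + t * v).
  have D0 : 0 <= D.
    have [D0 _] := sc_bnd h (ltac:(by rewrite (sc_0 h)) : H 0 0 <= 1).
    exact: le_trans D0.
  have n0 : 0 < 2 * D + `|x| + `|y| + 1.
    by rewrite ltr_wpDl ?ltr01 // !addr_ge0 // mulr_ge0.
  (* By this time the ray has left the box of half-width [D]: inside it, [t * (|u| + |v|)] is at
     most [2 * D + |x| + |y|]. *)
  exists ((2 * D + `|x| + `|y| + 1) / (`|u| + `|v|)).
  split; first by rewrite divr_gt0.
  set t := (_ / _); have t0 : 0 < t by rewrite divr_gt0.
  have tE : t * (`|u| + `|v|) = 2 * D + `|x| + `|y| + 1 by rewrite divfK // gt_eqF.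
  rewrite ltNge; apply/negP => /(sc_bnd h) [A B].
  have A' : `|t * u| <= D + `|x|.
    have -> : t * u = (x + t * u) - x by ring.
    by rewrite (le_trans (ler_normB _ _)) // lerD2r.
  have B' : `|t * v| <= D + `|y|.
    have -> : t * v = (y + t * v) - y by ring.
    by rewrite (le_trans (ler_normB _ _)) // lerD2r.
  rewrite normrM (gtr0_norm t0) in A'; rewrite normrM (gtr0_norm t0) in B'.
  move: tE; rewrite mulrDr; lra.
pose f s := H (x + s * u) (y + s * v).
have fc : continuous f.
  by move=> s; apply: (strong_convex_cvg h); apply: cvgD; do ?[exact: cvg_cst | apply: cvgM |
    exact: cvg_id].
have f0 : f 0 = H x y by rewrite /f !mul0r !addr0.
have [||s] := @IVT R f 0 t 1 (ltW t0).
- exact: continuous_subspaceT.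
- by rewrite ge_min le_max f0 (ltW hc) /= (ltW ht) orbT.
rewrite in_itv /= => /andP[s0 _] fs; exists s => //.
rewrite lt_neqAle s0 andbT; apply/eqP => s0E; move: fs; rewrite -s0E f0; lra.
Qed.

(** The default 0 does not occur for rays that start inside with a nonzero direction, by [exitP]. *)
Definition exit (R : realType) (H : R -> R -> R) (x y u v : R) : R :=
  xget 0 [set t | 0 < t /\ H (x + t * u) (y + t * v) = 1].

Lemma exitP (R : realType) (e L D : R) H (h : strong_convex e L D H)
  (x y u v : R) : H x y < 1 -> 0 < `|u| + `|v| ->
  0 < exit H x y u v /\ H (x + exit H x y u v * u) (y + exit H x y u v * v) = 1.
Proof.
move=> hc uv; have [t t0 ht] := exit_exists h hc uv.
exact: (@xgetPex _ 0 [set t | 0 < t /\ H (x + t * u) (y + t * v) = 1]) (ex_intro _ t (conj t0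
  ht)).
Qed.

Lemma exit_unique (R : realType) (e L D : R) H (h : strong_convex e L D H)
  (x y u v t : R) : H x y < 1 -> 0 < `|u| + `|v| -> 0 < t ->
  H (x + t * u) (y + t * v) = 1 -> t = exit H x y u v.
Proof.
move=> hc uv t0 ht; have [s0 hs] := exitP h hc uv.
have [ts|st|//] := ltgtP t (exit H x y u v).
- have [A _] := above_chord h u v (ltW t0) ts hc.
  by move: (A (ltac:(by rewrite hs))); rewrite ht ltxx.
- have [A _] := above_chord h u v (ltW s0) st hc.
  by move: (A (ltac:(by rewrite ht))); rewrite hs ltxx.
Qed.

(** [H] is below 1 at time [t - k] and above 1 at time [t + k]. Both inequalities are strict, so
    they persist for nearby rays, whose exit times are caught in between. *)
Lemma exit_cvg (R : realType) (e L D : R) H (h : strong_convex e L D H)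
  (T : Type) (F : set_system T) {FF : Filter F} (x y u v : T -> R) (x0 y0 u0 v0 : R) :
  x s @[s --> F] --> x0 -> y s @[s --> F] --> y0 ->
  u s @[s --> F] --> u0 -> v s @[s --> F] --> v0 ->
  H x0 y0 < 1 -> 0 < `|u0| + `|v0| ->
  exit H (x s) (y s) (u s) (v s) @[s --> F] --> exit H x0 y0 u0 v0.
Proof.
move=> cx cy cu cv hc uv; have [t0 ht0] := exitP h hc uv.
set t := exit H x0 y0 u0 v0 in t0 ht0 *.
apply/cvgrPdist_le => n n0.
pose k := Num.min n (t / 2).
have k0 : 0 < k by rewrite lt_min n0 divr_gt0.
have kn : k <= n by rewrite ge_min lexx.
have kt : k <= t / 2 by rewrite ge_min lexx orbT.
have tk0 : 0 <= t - k by lra.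
have Hc (r : R) : H (x s + r * u s) (y s + r * v s) @[s --> F] --> H (x0 + r * u0) (y0 + r * v0).
  by apply: (strong_convex_cvg h); do ?[exact: cvg_cst | exact: cx | exact: cy | exact: cu |
    exact: cv | apply: cvgD | apply: cvgM].
have [lo _] := above_chord h u0 v0 tk0 (ltac:(lra) : t - k < t) hc.
have [_ hi] := above_chord h u0 v0 (ltW t0) (ltac:(lra) : t < t + k) hc.
near=> s.
have h1 : H (x s) (y s) < 1 by near: s; apply: (cvgr_lt (H x0 y0)) => //; exact:
  (strong_convex_cvg h).
have h2 : 0 < `|u s| + `|v s|.
  by near: s; apply: (cvgr_gt (`|u0| + `|v0|)) => //; apply: cvgD; apply: cvg_norm.
have h3 : H (x s + (t - k) * u s) (y s + (t - k) * v s) < 1.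
  by near: s; apply: (cvgr_lt _ (Hc _)); apply: lo; rewrite ht0.
have h4 : 1 < H (x s + (t + k) * u s) (y s + (t + k) * v s).
  by near: s; apply: (cvgr_gt _ (Hc _)); apply: hi.
have [s0 hs] := exitP h h1 h2; set r := exit _ _ _ _ _ in s0 hs *.
have A1 : t - k <= r.
  rewrite leNgt; apply/negP => lt.
  have [_ B] := above_chord h (u s) (v s) (ltW s0) lt h1.
  by have := B hs; lra.
have A2 : r <= t + k.
  rewrite leNgt; apply/negP => lt.
  have [B _] := above_chord h (u s) (v s) (ltac:(lra) : 0 <= t + k) lt h1.
  by have := B (ltac:(by rewrite hs)); lra.
rewrite ler_norml; apply/andP; split; lra.
Unshelve. all: by end_near.
Qed.

(** * Existence of inscribed parallelograms *)

(** The diagonals, not the sides, are parallel to the axes; [a] and [b] are their half-lengths. The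
    chord directions are hidden in the frame in which [H] is read. *)
Definition parallelogram (R : realType) (H : R -> R -> R) (x y a b : R) : Prop :=
  [/\ 0 < a, 0 < b, H (x + a) y = 1 /\ H (x - a) y = 1 & H x (y + b) = 1 /\ H x (y - b) = 1].

(** At a true leftmost point the vertical chord may degenerate; an interior point within [rho / 4]
    of the infimum avoids this. *)
Lemma left_extreme (R : realType) (e L D : R) H (h : strong_convex e L D H) (rho : R) :
  0 < rho -> H (- rho) 0 < 1 ->
  exists x y, [/\ H x y < 1, x < 0 & forall x' y', H x' y' < 1 -> x - rho / 4 < x'].
Proof.
move=> r0 hr; pose E := [set x | exists y, H x y < 1].
have E0 : has_inf E.
  split; first by exists (- rho), 0.
  exists (- D) => x [y /ltW /(sc_bnd h) [+ _]].
  by rewrite ler_norml => /andP[].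
have [x [y hxy] xlt] := inf_adherent (ltac:(by rewrite divr_gt0) : 0 < rho / 4) E0.
have lb x' y' : H x' y' < 1 -> inf E <= x'.
  by move=> ?; apply: ge_inf; [case: E0 | exists y'].
exists x, y; split => //.
  have := lb _ _ hr; lra.
by move=> x' y' /lb; lra.
Qed.

(** If the left half-chord were at least as long as the right one, [half_chord_ge] would make both
    at least [rho / 2]; then [(x - rho / 4, y)] would be interior, too far to the left. *)
Lemma exit_left_lt_right (R : realType) (e L D : R) H (h : strong_convex e L D H)
  (x y b rho : R) : 0 < rho -> H rho 0 < 1 -> H x y < 1 -> x <= 0 ->
  0 < b -> H x (y + b) = 1 -> H x (y - b) = 1 ->
  (forall x' y', H x' y' < 1 -> x - rho / 4 < x') ->
  exit H x y (-1) 0 < exit H x y 1 0.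
Proof.
move=> r0 hr hc x0 b0 hT hB ext.
have u1 : 0 < `|1 : R| + `|0 : R| by rewrite normr1 normr0 addr0.
have u2 : 0 < `|-1 : R| + `|0 : R| by rewrite normrN normr1 normr0 addr0.
have [s0 hs] := exitP h hc u1; have [t0 ht] := exitP h hc u2.
set s := exit _ _ _ 1 _ in s0 hs *; set t := exit _ _ _ _ _ in t0 ht *.
rewrite ltNge; apply/negP => st.
have hs' : H (x + s) y = 1 by move: hs; rewrite mulr1 mulr0 addr0.
have ht' : H (x - t) y = 1 by move: ht; rewrite mulrN1 mulr0 addr0.
have A := half_chord_ge h s0 st b0 (ltW hc) hB hT hs' ht' x0 hr.
have [B _] := above_chord h (-1) 0 (ltac:(lra) : 0 <= rho / 4) (ltac:(lra) : rho / 4 < t) hc.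
have /ext := B (ltac:(by rewrite ht)).
by rewrite mulrN1 ltxx.
Qed.

Lemma parallelogram_exists (R : realType) (e L D : R) H (h : strong_convex e L D H) (rho : R) :
  0 < rho -> H rho 0 < 1 -> H (- rho) 0 < 1 ->
  exists x y a b, parallelogram H x y a b.
Proof.
move=> r0 hr hr'.
have [xV [yV [hV V0 extV]]] := left_extreme h r0 hr'.
have [xW [yW [hW W0 extW]]] := left_extreme (strong_convex_flip h) r0 (ltac:(by rewrite opprK) :
  H (- - rho) 0 < 1).
(* The vertical chord moves from the left extreme [xV] to the right one, which is [- xW] because [W]
   was found in the mirror image. [f] is the excess of the right over the left half of the
   horizontal chord through its midpoint. *)
pose cx s := (1 - s) * xV + s * (- xW).
pose cy s := (1 - s) * yV + s * yW.
pose up s := exit H (cx s) (cy s) 0 1.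
pose dn s := exit H (cx s) (cy s) 0 (-1).
pose my s := cy s + (up s - dn s) / 2.
pose b s := (up s + dn s) / 2.
pose f s := exit H (cx s) (my s) 1 0 - exit H (cx s) (my s) (-1) 0.
have u1 : 0 < `|0 : R| + `|1 : R| by rewrite normr1 normr0 add0r.
have u2 : 0 < `|0 : R| + `|-1 : R| by rewrite normrN normr1 normr0 add0r.
have v1 : 0 < `|1 : R| + `|0 : R| by rewrite addrC.
have v2 : 0 < `|-1 : R| + `|0 : R| by rewrite addrC.
have hc s : 0 <= s -> s <= 1 -> H (cx s) (cy s) < 1.
  move=> s0; rewrite le_eqVlt => /orP[/eqP ->|s1].
    by rewrite /cx /cy subrr !mul0r !mul1r !add0r.
  exact: (convex2_lt1 h s0 s1 hV (ltW hW)).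
have hup s : 0 <= s -> s <= 1 -> 0 < up s /\ H (cx s) (cy s + up s) = 1.
  move=> s0 s1; have := exitP h (hc _ s0 s1) u1.
  by rewrite mulr0 addr0 mulr1.
have hdn s : 0 <= s -> s <= 1 -> 0 < dn s /\ H (cx s) (cy s - dn s) = 1.
  move=> s0 s1; have := exitP h (hc _ s0 s1) u2.
  by rewrite mulr0 addr0 mulrN1.
have b0 s : 0 <= s -> s <= 1 -> 0 < b s.
  by move=> s0 s1; have [? _] := hup s s0 s1; have [? _] := hdn s s0 s1; rewrite /b; lra.
have hT s : 0 <= s -> s <= 1 -> H (cx s) (my s + b s) = 1.
  by move=> s0 s1; have [_ <-] := hup s s0 s1; congr H; rewrite /my /b; lra.
have hB s : 0 <= s -> s <= 1 -> H (cx s) (my s - b s) = 1.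
  by move=> s0 s1; have [_ <-] := hdn s s0 s1; congr H; rewrite /my /b; lra.
have hm s : 0 <= s -> s <= 1 -> H (cx s) (my s) < 1.
  move=> s0 s1; have [p0 hp] := hup s s0 s1; have [q0 hq] := hdn s s0 s1.
  have [pq|pq] := lerP (dn s) (up s).
    have [+ _] := above_chord h 0 1 (ltac:(lra) : 0 <= (up s - dn s) / 2) (ltac:(lra) : (up s -
      dn s) / 2 < up s) (hc _ s0 s1).
    by rewrite !mulr0 !addr0 !mulr1; apply; rewrite hp.
  have [+ _] := above_chord h 0 (-1) (ltac:(lra) : 0 <= (dn s - up s) / 2) (ltac:(lra) : (dn s -
    up s) / 2 < dn s) (hc _ s0 s1).
  rewrite !mulr0 !addr0 !mulrN1 hq => /(_ (lexx _)).
  by have -> : cy s - (dn s - up s) / 2 = my s by rewrite /my; lra.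
have fc : {within `[0, 1], continuous f}.
  apply: continuous_in_subspaceT => s; rewrite inE /= in_itv /= => /andP[s0 s1].
  have cxc : cx r @[r --> s] --> cx s.
    by rewrite /cx; (apply: cvgD; apply: cvgM; [apply: cvgB; [exact: cvg_cst | exact: cvg_id] |
      exact: cvg_cst | exact: cvg_id | exact: cvg_cst]).
  have cyc : cy r @[r --> s] --> cy s.
    by rewrite /cy; (apply: cvgD; apply: cvgM; [apply: cvgB; [exact: cvg_cst | exact: cvg_id] |
      exact: cvg_cst | exact: cvg_id | exact: cvg_cst]).
  have upc : up r @[r --> s] --> up s.
    by apply: (exit_cvg h) => //; [exact: cvg_cst | exact: cvg_cst | exact: hc].
  have dnc : dn r @[r --> s] --> dn s.
    by apply: (exit_cvg h) => //; [exact: cvg_cst | exact: cvg_cst | exact: hc].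
  have myc : my r @[r --> s] --> my s.
    by apply: cvgD => //; apply: cvgM; [exact: cvgB | exact: cvg_cst].
  by apply: cvgB; apply: (exit_cvg h) => //; do ?[exact: cvg_cst | exact: hm].
have f0 : 0 < f 0.
  have lt0 : (0 : R) <= 1 by [].
  rewrite /f subr_gt0; apply: (exit_left_lt_right h r0 hr (hm _ _ _) _ (b0 0 _ _) (hT _ _ _) (hB
    _ _ _)) => //.
    by rewrite /cx subr0 mul1r mul0r addr0 ltW.
  by rewrite /cx subr0 mul1r mul0r addr0.
have f1 : f 1 < 0.
  have lt0 : (0 : R) <= 1 by [].
  have h' := strong_convex_flip h.
  have hm1 : H (- - cx 1) (my 1) < 1 by rewrite opprK; exact: hm.
  have cx1 : cx 1 = - xW by rewrite /cx subrr mul0r mul1r add0r.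
  have := @exit_left_lt_right _ _ _ _ _ h' (- cx 1) (my 1) (b 1) rho r0 hr' hm1.
  rewrite opprK hT // hB // cx1 opprK => /(_ (ltW W0) (b0 _ lt0 (lexx _)) erefl erefl extW).
  rewrite /f subr_lt0.
  (* Reflection exchanges the two exit times; [exit_unique] identifies them. *)
  have [p0 hp] := exitP h (hm 1 lt0 (lexx _)) v1; have [q0 hq] := exitP h (hm 1 lt0 (lexx _)) v2.
  have hW1 : H (- xW) (my 1) < 1 by rewrite -cx1; exact: hm.
  rewrite -(exit_unique h' hW1 v1 q0); last by rewrite -[RHS]hq cx1; congr H; ring.
  rewrite -(exit_unique h' hW1 v2 p0) //.
  by rewrite -[RHS]hp cx1; congr H; ring.
have [|s] := @IVT R f 0 1 0 ler01 fc.
  by rewrite ge_min le_max (ltW f0) (ltW f1) orbT.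
rewrite in_itv /= => /andP[s0 s1] /subr0_eq fs.
have [p0 hp] := exitP h (hm s s0 s1) v1; have [q0 hq] := exitP h (hm s s0 s1) v2.
exists (cx s), (my s), (exit H (cx s) (my s) 1 0), (b s); split => //; first exact: b0.
- split; first by rewrite -[RHS]hp mulr1 mulr0 addr0.
  by rewrite fs -[RHS]hq mulrN1 mulr0 addr0.
- by split; [exact: hT | exact: hB].
Qed.

(** * Stability of inscribed parallelograms *)

(** The tolerance [n] lets a parallelogram inscribed at another angle be turned into the current
    frame and compared there. *)
Definition near_parallelogram (R : realType) (n : R) (H : R -> R -> R) (x y a b : R) : Prop :=
  [/\ `|H (x + a) y - 1| <= n, `|H (x - a) y - 1| <= n,
      `|H x (y + b) - 1| <= n & `|H x (y - b) - 1| <= n].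

Lemma near_parallelogram_swap (R : realType) (n : R) H (x y a b : R) :
  near_parallelogram n H x y a b -> near_parallelogram n (fun x y => H y x) y x b a.
Proof. by case. Qed.

Lemma near_parallelogram_flip (R : realType) (n : R) H (x y a b : R) :
  near_parallelogram n H x y a b -> near_parallelogram n (fun x y => H (- x) y) (- x) y a b.
Proof. by case=> *; split; rewrite ?opprD ?opprK. Qed.

Lemma near_parallelogram_center (R : realType) (e L D : R) H (h : strong_convex e L D H)
  (n x y a b : R) : near_parallelogram n H x y a b -> H x y <= 1 + n.
Proof.
case=> /ler_normlW A /(ler_normlW) B _ _.
have h0 : (0 : R) <= 1 / 2 by lra.
have := sc_conv h (x + a) y (x - a) y h0 (ltac:(lra) : 1 / 2 <= 1).
have -> : (1 - 1 / 2) * (x + a) + 1 / 2 * (x - a) = x by lra.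
have -> : (1 - 1 / 2) * y + 1 / 2 * y = y by lra.
set Q := e * _ * _ * _.
have Q0 : 0 <= Q.
  have e0 := sc_e h; apply: mulr_ge0; last by rewrite addr_ge0 ?sqr_ge0.
  lra.
move: Q Q0 => Q Q0; lra.
Qed.

(* The factor [k < 1] is what strong convexity buys: the chord from [(x, y - b)]
   to the moved vertex has to pass strictly below the boundary. *)
Lemma vertex_shift (R : realType) (e L D r A : R) : 0 < e -> 0 < r -> r <= A ->
  exists k C, [/\ 0 <= k, k < 1, 0 <= C & forall H, strong_convex e L D H ->
    forall x y a b d q n, 0 <= n -> r <= a <= A -> r <= b <= A -> `|x| <= A -> `|y| <= A ->
    0 <= q -> a + d <= 3 * A -> 1 - n <= H (x + a) y -> H x (y - b) <= 1 + n ->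
    H x y <= 1 + n -> H (x + (a + d)) (y + q) <= 1 + n -> d * b <= k * (q * a) + C * n].
Proof.
move=> e0 r0 rA; have A0 : 0 < A by lra.
(* [M] is a Lipschitz constant on the region concerned; its summand [e * r ^ 2 / A] keeps [k]
   nonnegative. *)
pose M := `|L| * (1 + 8 * A) + e * r ^+ 2 / A + 1.
have eA0 : 0 < e * r ^+ 2 / A by rewrite divr_gt0 // mulr_gt0 // exprn_gt0.
have L0 : 0 <= `|L| * (1 + 8 * A) by rewrite mulr_ge0 //; lra.
have M0 : 0 < M by rewrite /M; lra.
pose k := 1 - e * r ^+ 2 / A / M.
pose C := 18 * A ^+ 3 / (e * r ^+ 3) + 2 * r / M.
have C1 : 0 <= 18 * A ^+ 3 / (e * r ^+ 3).
  by rewrite divr_ge0 ?mulr_ge0 // ?exprn_ge0 // ltW.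
have C2 : 0 <= 2 * r / M by rewrite divr_ge0 ?mulr_ge0 // ltW.
have k0 : 0 <= k by rewrite /k subr_ge0 ler_pdivrMr // mul1r /M; lra.
have k1 : k < 1 by rewrite /k ltrBlDr ltrDl divr_gt0.
have CE n : C * n = 18 * A ^+ 3 / (e * r ^+ 3) * n + 2 * r / M * n by rewrite /C mulrDl.
exists k, C; split => //; first by rewrite addr_ge0.
move=> H h x y a b d q n n0 /andP[ra aA] /andP[rb bA] xA yA q0 adA hR hB hc hR'.
have a0 : 0 < a by lra.
have b0 : 0 < b by lra.
have [d0|d0] := lerP d 0.
  apply: (@le_trans _ _ 0); first by rewrite mulr_le0_ge0 // ltW.
  by rewrite addr_ge0 // ?mulr_ge0 // ?addr_ge0 // ltW.
have ad0 : 0 < a + d by lra.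
(* If [a * q <= d * b], the old vertex lies in the triangle spanned by the moved vertex,
   [(x, y - b)] and [(x, y)]. Strong convexity would push it inside the body, so [d * b] is of the
   order of the defect [n]. *)
have [G|G] := lerP (a * q) (d * b).
  have bad0 : 0 < b * (a + d) by rewrite mulr_gt0.
  have bN : b != 0 by rewrite gt_eqF.
  have adN : a + d != 0 by rewrite gt_eqF.
  have l0 : 0 <= a / (a + d) by rewrite divr_ge0 // ltW.
  have m0 : 0 <= a * q / (b * (a + d)) by rewrite divr_ge0 ?mulr_ge0 // ltW.
  have n0' : 0 <= (d * b - a * q) / (b * (a + d)) by rewrite divr_ge0 ?subr_ge0 // ltW.
  set l := a / (a + d) in l0 *; set m := a * q / _ in m0 *; set o := (_ - _) / _ in n0' *.
  have s1 : l + m + o = 1 by rewrite /l /m /o; field; rewrite bN adN.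
  have xE : x + a = l * (x + (a + d)) + m * x + o * x.
    by rewrite /l /m /o; field; rewrite bN adN.
  have yE : y = l * (y + q) + m * (y - b) + o * y.
    by rewrite /l /m /o; field; rewrite bN adN.
  have := strong_convex3 h l0 m0 n0' s1 xE yE.
  have sq2 : r ^+ 2 <= (a + d) ^+ 2 by apply: lerXn2r; rewrite ?nnegrE; clear -ra r0 d0; lra.
  have p1 : r ^+ 2 <= (x + (a + d) - x) ^+ 2 + (y + q - (y - b)) ^+ 2.
    have -> : x + (a + d) - x = a + d by ring.
    by rewrite (le_trans sq2) // lerDl sqr_ge0.
  have p2 : r ^+ 2 <= (x + (a + d) - x) ^+ 2 + (y + q - y) ^+ 2.
    have -> : x + (a + d) - x = a + d by ring.
    by rewrite (le_trans sq2) // lerDl sqr_ge0.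
  have lm0 : 0 <= l * m by rewrite mulr_ge0.
  have lo0 : 0 <= l * o by rewrite mulr_ge0.
  have := ler_wpM2l lm0 p1; have := ler_wpM2l lo0 p2.
  have : 0 <= m * o * ((x - x) ^+ 2 + (y - b - y) ^+ 2).
    by apply: mulr_ge0; [exact: mulr_ge0 | rewrite addr_ge0 ?sqr_ge0].
  have := ler_wpM2l l0 hR'; have := ler_wpM2l m0 hB; have := ler_wpM2l n0' hc.
  move: (l * o * (_ + _)) (l * m * (_ + _)) (m * o * (_ + _)) => S1 S2 S3.
  move: (l * H _ _) (m * H _ _) (o * H _ _) => T1 T2 T3 hT3 hT2 hT1 hS3 hS1 hS2 hH.
  have K1 : e * (S1 + S2 + S3) <= 2 * n.
    have : T1 + T2 + T3 <= 1 + n.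
      have -> : 1 + n = l * (1 + n) + m * (1 + n) + o * (1 + n) by rewrite -!mulrDl s1 mul1r.
      by clear -hT1 hT2 hT3; lra.
    by have := e0; clear -hH hR; lra.
  have K2 : e * (l * (1 - l) * r ^+ 2) <= 2 * n.
    apply: le_trans K1; rewrite ler_pM2l //.
    have -> : 1 - l = m + o by rewrite -s1; ring.
    by clear -hS1 hS2 hS3; lra.
  have lE : l * (1 - l) = a * d / (a + d) ^+ 2 by rewrite /l; field.
  have K3 : e * r ^+ 2 * (a * d) <= 2 * n * (a + d) ^+ 2.
    have ad2 : 0 < (a + d) ^+ 2 by rewrite exprn_gt0.
    rewrite -ler_pdivrMr //; move: K2; rewrite lE; congr (_ <= _).
    by field.
  have K4 : 2 * n * (a + d) ^+ 2 <= 2 * n * (9 * A ^+ 2).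
    rewrite ler_wpM2l ?mulr_ge0 //.
    have -> : 9 * A ^+ 2 = (3 * A) ^+ 2 by ring.
    by apply: lerXn2r adA; rewrite nnegrE ltW // mulr_gt0.
  have K5 : e * r ^+ 3 * (d * b) <= 18 * A ^+ 3 * n.
    have e2 : 0 <= e * r ^+ 2 * d by rewrite !mulr_ge0 ?exprn_ge0 ?ltW.
    have : e * r ^+ 2 * d * (r * b) <= e * r ^+ 2 * d * (a * A).
      by rewrite ler_wpM2l // ler_pM // ltW.
    have := ler_wpM2r (ltW A0) (le_trans K3 K4).
    by clear; lra.
  have er3 : 0 < e * r ^+ 3 by rewrite mulr_gt0 // exprn_gt0.
  apply: (@le_trans _ _ (18 * A ^+ 3 / (e * r ^+ 3) * n)).
    by rewrite mulrAC ler_pdivlMr // mulrC.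
  have kqa : 0 <= k * (q * a) by apply: mulr_ge0 => //; apply: mulr_ge0 => //; exact: ltW.
  have := mulr_ge0 C2 n0; rewrite CE; move: kqa; clear.
  by move: (k * _) (2 * r / M * n) (18 * _ / _ * n) => X Y Z; lra.
(* Otherwise the chord from the moved vertex to [(x, y - b)] meets height [y] at an abscissa
   [z <= x + a]. Strong convexity gains [e * (q * b)] there, and the Lipschitz bound converts this
   gain into a distance between [z] and [x + a], whence the factor [k]. *)
have qb : 0 < q + b by lra.
pose t := q / (q + b).
have tE : t * (q + b) = q by rewrite divfK // gt_eqF.
have t0 : 0 <= t by rewrite divr_ge0 // ltW.
have t1 : t <= 1 by rewrite ler_pdivrMr // mul1r; lra.
have := sc_conv h (x + (a + d)) (y + q) x (y - b) t0 t1.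
have -> : (1 - t) * (y + q) + t * (y - b) = y by nra.
set z := (1 - t) * _ + _.
have zE : x + a - z = (a * q - d * b) / (q + b).
  by rewrite /z /t; field; rewrite gt_eqF.
set w := e * t * _ * _.
have wE : w = e * ((1 - t) * t * ((a + d) ^+ 2)) + e * (q * b).
  by rewrite /w /t; field; rewrite gt_eqF.
have w0 : e * (q * b) <= w.
  by rewrite wE lerDr mulr_ge0 ?(ltW e0) // mulr_ge0 ?sqr_ge0 // mulr_ge0 // subr_ge0.
move=> hz.
have hz' : H z y <= 1 + n - e * (q * b).
  have : (1 - t) * H (x + (a + d)) (y + q) <= (1 - t) * (1 + n) by rewrite ler_wpM2l // subr_ge0.
  have : t * H x (y - b) <= t * (1 + n) by rewrite ler_wpM2l.
  move: hz; move: (_ * H _ _) (_ * H _ _) => T1 T2; lra.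
have G0 : 0 <= (a * q - d * b) / (q + b) by rewrite divr_ge0 ?ltW ?subr_gt0.
have z1 : x <= z.
  have -> : z = x + (1 - t) * (a + d) by rewrite /z; ring.
  by rewrite lerDl mulr_ge0 ?subr_ge0 // ltW.
have z2 : z <= x + a by rewrite -subr_ge0 zE.
have lip : H (x + a) y - H z y <= M * ((a * q - d * b) / (q + b)).
  apply: (le_trans (sc_lip h _ _ _ _)); rewrite subrr normr0 addr0 zE (ger0_norm G0).
  rewrite ler_wpM2r //.
  have N1 : `|x + a| <= 2 * A by rewrite (le_trans (ler_normD _ _)) // (gtr0_norm a0); lra.
  have N2 : `|z| <= 2 * A.
    by move: xA; rewrite !ler_norml => /andP[? ?]; apply/andP; split; lra.
  apply: (@le_trans _ _ (`|L| * (1 + `|x + a| + `|y| + `|z| + `|y|))).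
    by rewrite ler_wpM2r ?ler_norm // !addr_ge0.
  apply: (@le_trans _ _ (`|L| * (1 + 8 * A))); last by rewrite /M; lra.
  by rewrite ler_wpM2l //; lra.
have lip' : M * ((a * q - d * b) / (q + b)) <= M * ((a * q - d * b) / r).
  rewrite ler_pM2l // ler_pM2l ?subr_gt0 // lef_pV2 ?posrE //; lra.
have K : e * (q * b) <= 2 * n + M * ((a * q - d * b) / r) by lra.
have K2 : M * (d * b) + e * r * (q * b) <= 2 * r * n + M * (a * q).
  have := ler_wpM2l (ltW r0) K.
  have -> : r * (2 * n + M * ((a * q - d * b) / r)) = 2 * r * n + M * (a * q - d * b).
    by field; rewrite gt_eqF.
  lra.
have K3 : e * r ^+ 2 / A * (q * a) <= e * r * (q * b).
  have -> : e * r ^+ 2 / A * (q * a) = e * r * (q * (r * (a / A))) by field; rewrite gt_eqF.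
  rewrite ler_pM2l ?mulr_gt0 // ler_wpM2l //.
  apply: (@le_trans _ _ (r * 1)); last by lra.
  by rewrite ler_pM2l // ler_pdivrMr // mul1r.
have K4 : d * b <= k * (q * a) + 2 * r / M * n.
  rewrite -(ler_pM2l M0).
  have -> : M * (k * (q * a) + 2 * r / M * n) = M * (a * q) - e * r ^+ 2 / A * (q * a) + 2 * r *
    n.
    by rewrite /k; field; rewrite !gt_eqF.
  lra.
apply: (le_trans K4); rewrite CE lerD2l lerDr mulr_ge0 //.
Qed.

Definition bounded_parallelogram (R : realType) (r A x y a b : R) : Prop :=
  [/\ r <= a <= A, r <= b <= A, `|x| <= A & `|y| <= A].

(** [vertex_shift] for the right vertex, displaced by [x' - x + (a' - a)] and [y' - y]; reflections
    in the axes produce the absolute values. The constants precede [H], so that one choice serves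
    the frames of all angles. *)
Lemma half_diagonal_shift (R : realType) (e L D r A : R) : 0 < e -> 0 < r -> r <= A ->
  exists k C, [/\ 0 <= k, k < 1, 0 <= C & forall H, strong_convex e L D H ->
    forall x y a b x' y' a' b' n, 0 <= n ->
    bounded_parallelogram r A x y a b -> bounded_parallelogram r A x' y' a' b' ->
    near_parallelogram n H x y a b -> near_parallelogram n H x' y' a' b' ->
    (`|x' - x| + (a' - a)) * b <= k * (`|y' - y| * a) + C * n].
Proof.
move=> e0 r0 rA; have [k [C [k0 k1 C0 shift]]] := vertex_shift L D e0 r0 rA.
exists k, C; split => //.
have step1 H : strong_convex e L D H -> forall x y a b x' y' a' b' n, 0 <= n ->
    bounded_parallelogram r A x y a b -> bounded_parallelogram r A x' y' a' b' ->
    near_parallelogram n H x y a b -> near_parallelogram n H x' y' a' b' -> 0 <= y' - y ->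
    (x' - x + (a' - a)) * b <= k * ((y' - y) * a) + C * n.
  move=> h x y a b x' y' a' b' n n0 [ra rb xA yA] [/andP[_ a'A] _ x'A _] nn [nR' _ _ _] q0.
  have hc := near_parallelogram_center h nn; case: nn => nR _ _ nB.
  apply: (shift _ h x y) => //.
  - have -> : a + (x' - x + (a' - a)) = x' - x + a' by ring.
    move: xA x'A a'A; rewrite !ler_norml; clear => /andP[? ?] /andP[? ?] ?; lra.
  - by move: nR; rewrite ler_norml; clear => /andP[? ?]; lra.
  - by move: nB; rewrite ler_norml; clear => /andP[? ?]; lra.
  - have -> : x + (a + (x' - x + (a' - a))) = x' + a' by ring.
    have -> : y + (y' - y) = y' by ring.
    by move: nR'; rewrite ler_norml; clear => /andP[? ?]; lra.
have step2 H : strong_convex e L D H -> forall x y a b x' y' a' b' n, 0 <= n ->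
    bounded_parallelogram r A x y a b -> bounded_parallelogram r A x' y' a' b' ->
    near_parallelogram n H x y a b -> near_parallelogram n H x' y' a' b' ->
    (x' - x + (a' - a)) * b <= k * (`|y' - y| * a) + C * n.
  move=> h x y a b x' y' a' b' n n0 bp bp' np np'.
  have [q0|q0] := ger0P (y' - y); first exact: (step1 _ h _ _ _ _ _ _ _ _ _ n0 bp bp' np np').
  have h' := strong_convex_swap (strong_convex_flip (strong_convex_swap h)).
  have fl u v c d : near_parallelogram n H u v c d ->
      near_parallelogram n (fun x y => H x (- y)) u (- v) c d.
    by move=> /near_parallelogram_swap/near_parallelogram_flip/near_parallelogram_swap.
  have flb u v c d : bounded_parallelogram r A u v c d -> bounded_parallelogram r A u (- v) c d.
    by case=> *; split => //; rewrite normrN.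
  have := step1 _ h' _ _ _ _ _ _ _ _ _ n0 (flb _ _ _ _ bp) (flb _ _ _ _ bp') (fl _ _ _ _ np) (fl
    _ _ _ _ np').
  have -> : - y' - - y = - (y' - y) by ring.
  by apply; lra.
move=> H h x y a b x' y' a' b' n n0 bp bp' np np'.
have [q0|q0] := ger0P (x' - x); first exact: (step2 _ h _ _ _ _ _ _ _ _ _ n0 bp bp' np np').
have h' := strong_convex_flip h.
have flb u v c d : bounded_parallelogram r A u v c d -> bounded_parallelogram r A (- u) v c d.
  by case=> *; split => //; rewrite normrN.
have := step2 _ h' _ _ _ _ _ _ _ _ _ n0 (flb _ _ _ _ bp) (flb _ _ _ _ bp')
  (near_parallelogram_flip np) (near_parallelogram_flip np').
by have -> : - x' - - x = - (x' - x) by ring.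
Qed.

(* AM-GM makes one of the two sums of shifts nonnegative: [a' b + a b' >= 2 min(a b, a' b')]. *)
Lemma shift_system (R : realType) (k C r A n P Q a b a' b' : R) :
  0 <= k -> k < 1 -> 0 <= C -> 0 < r -> r <= A -> 0 <= n -> 0 <= P -> 0 <= Q ->
  r <= a <= A -> r <= b <= A -> r <= a' <= A -> r <= b' <= A ->
  (P + (a' - a)) * b <= k * (Q * a) + C * n ->
  (Q + (b' - b)) * a <= k * (P * b) + C * n ->
  (P + (a - a')) * b' <= k * (Q * a') + C * n ->
  (Q + (b - b')) * a' <= k * (P * b') + C * n ->
  P + Q <= 2 * C / ((1 - k) * r) * n.
Proof.
move=> k0 k1 C0 r0 rA n0 P0 Q0 /andP[ra aA] /andP[rb bA] /andP[ra' aA'] /andP[rb' bA'] I1 I2 I3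
  I4.
have kr : 0 < (1 - k) * r by rewrite mulr_gt0 // subr_gt0.
have fin u v : r <= u -> r <= v -> (1 - k) * (P * v + Q * u) <= 2 * C * n ->
    P + Q <= 2 * C / ((1 - k) * r) * n.
  move=> ru rv le; rewrite mulrAC ler_pdivlMr //; apply: le_trans le.
  rewrite mulrC -mulrA ler_pM2l ?subr_gt0 //.
  by rewrite mulrDr lerD // mulrC ler_wpM2l.
have [m|m] := lerP (a * b) (a' * b').
  apply: (fin a b) => //.
  suff : 2 * (a * b) <= a' * b + a * b' by move: I1 I2; clear; lra.
  have a0 : 0 < a by lra.
  have b0 : 0 < b by lra.
  have : 0 <= (a' * b - a * b') ^+ 2 by rewrite sqr_ge0.
  have S0 : 0 <= a' * b + a * b' by rewrite addr_ge0 // mulr_ge0 //; lra.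
  move=> sq; rewrite leNgt; apply/negP => lt.
  have ab0 : 0 < a * b by rewrite mulr_gt0.
  have : (a' * b + a * b') ^+ 2 < (2 * (a * b)) ^+ 2 by rewrite ltrXn2r // nnegrE; lra.
  have := ler_wpM2l (ltW ab0) m.
  move: sq; clear; lra.
apply: (fin a' b') => //.
suff : 2 * (a' * b') <= a' * b + a * b' by move: I3 I4; clear; lra.
have a0 : 0 < a' by lra.
have b0 : 0 < b' by lra.
have : 0 <= (a' * b - a * b') ^+ 2 by rewrite sqr_ge0.
have S0 : 0 <= a' * b + a * b' by rewrite addr_ge0 // mulr_ge0 //; lra.
move=> sq; rewrite leNgt; apply/negP => lt.
have ab0 : 0 < a' * b' by rewrite mulr_gt0.
have : (a' * b + a * b') ^+ 2 < (2 * (a' * b')) ^+ 2 by rewrite ltrXn2r // nnegrE; lra.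
have := ler_wpM2l (ltW ab0) (ltW m).
move: sq; clear; lra.
Qed.

Lemma parallelogram_stable (R : realType) (e L D r A : R) : 0 < e -> 0 < r -> r <= A ->
  exists2 C, 0 <= C & forall H, strong_convex e L D H ->
    forall x y a b x' y' a' b' n, 0 <= n ->
    bounded_parallelogram r A x y a b -> bounded_parallelogram r A x' y' a' b' ->
    near_parallelogram n H x y a b -> near_parallelogram n H x' y' a' b' ->
    [/\ `|x' - x| <= C * n, `|y' - y| <= C * n, `|a' - a| <= C * n & `|b' - b| <= C * n].
Proof.
move=> e0 r0 rA; have [k [C [k0 k1 C0 shift]]] := half_diagonal_shift L D e0 r0 rA.
have A0 : 0 < A by lra.
pose C1 := 2 * C / ((1 - k) * r).
have C10 : 0 <= C1 by apply: divr_ge0; [exact: mulr_ge0 | apply: ltW; rewrite mulr_gt0 //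
  subr_gt0].
(* [C1] controls the center. Put back into a single inequality, it controls the half-diagonals after
   division by one of length at least [r]. *)
pose C2 := C1 + (A * C1 + C) / r.
have C20 : 0 <= (A * C1 + C) / r by apply: divr_ge0; [apply: addr_ge0 => //; apply: mulr_ge0 =>
  //; exact: ltW | exact: ltW].
exists C2; first exact: addr_ge0.
move=> H h x y a b x' y' a' b' n n0 bp bp' np np'.
have swp u v c d : bounded_parallelogram r A u v c d -> bounded_parallelogram r A v u d c by case.
have I1 := shift _ h _ _ _ _ _ _ _ _ _ n0 bp bp' np np'.
have I2 := shift _ (strong_convex_swap h) _ _ _ _ _ _ _ _ _ n0 (swp _ _ _ _ bp) (swp _ _ _ _ bp')
  (near_parallelogram_swap np) (near_parallelogram_swap np').
have I3 := shift _ h _ _ _ _ _ _ _ _ _ n0 bp' bp np' np.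
have I4 := shift _ (strong_convex_swap h) _ _ _ _ _ _ _ _ _ n0 (swp _ _ _ _ bp') (swp _ _ _ _ bp)
  (near_parallelogram_swap np') (near_parallelogram_swap np).
rewrite (distrC x) in I3 I4; rewrite (distrC y) in I3 I4.
have P0 := normr_ge0 (x' - x); have Q0 := normr_ge0 (y' - y).
move: (`|x' - x|) (`|y' - y|) P0 Q0 I1 I2 I3 I4 => P Q P0 Q0 I1 I2 I3 I4.
have [ra rb _ _] := bp; have [ra' rb' _ _] := bp'.
have PQ : P + Q <= C1 * n := shift_system k0 k1 C0 r0 rA n0 P0 Q0 ra rb ra' rb' I1 I2 I3 I4.
have le2 : C1 * n <= C2 * n by rewrite ler_wpM2r // lerDl.
have fin u v s w : 0 <= u -> 0 <= w -> w <= P + Q -> r <= v <= A -> r <= s <= A ->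
    forall z, (u + z) * v <= k * (w * s) + C * n -> z <= C2 * n.
  move=> u0 w0 wPQ /andP[rv vA] /andP[rs sA] z le.
  have v0 : 0 < v by lra.
  have K1 : k * (w * s) <= A * (C1 * n).
    apply: (@le_trans _ _ (1 * (w * s))).
      by rewrite ler_wpM2r ?(ltW k1) // mulr_ge0 //; lra.
    rewrite mul1r mulrC; apply: ler_pM => //; [lra | exact: le_trans PQ].
  have K2 : z * v <= A * (C1 * n) + C * n.
    by have := mulr_ge0 u0 (ltW v0); move: le K1; clear; lra.
  have [z0|z0] := lerP z 0.
    by apply: (le_trans z0); rewrite mulr_ge0 // addr_ge0.
  have K3 : z * r <= (A * C1 + C) * n.
    have : z * r <= z * v by rewrite ler_pM2l.
    by move: K2; clear; lra.
  have K4 : z <= (A * C1 + C) / r * n by rewrite mulrAC ler_pdivlMr.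
  by apply: (le_trans K4); rewrite ler_wpM2r // lerDr.
split.
- by move: PQ le2 Q0; clear; lra.
- by move: PQ le2 P0; clear; lra.
- rewrite ler_norml lerNl opprB; apply/andP; split.
    by apply: (fin P b' a' Q) => //; lra.
  by apply: (fin P b a Q) => //; lra.
- rewrite ler_norml lerNl opprB; apply/andP; split.
    by apply: (fin Q a' b' P) => //; lra.
  by apply: (fin Q a b P) => //; lra.
Qed.

Lemma parallelogram_near (R : realType) (n : R) H (x y a b : R) : 0 <= n ->
  parallelogram H x y a b -> near_parallelogram n H x y a b.
Proof. by move=> n0 [_ _ [h1 h2] [h3 h4]]; split; rewrite ?h1 ?h2 ?h3 ?h4 subrr normr0. Qed.

Lemma parallelogram_big (R : realType) (e L D : R) H (h : strong_convex e L D H)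
  (x y a b rho : R) : H rho 0 < 1 -> H (- rho) 0 < 1 -> parallelogram H x y a b -> rho <= 2 * a.
Proof.
move=> hr hr' pg; have [a0 b0 [hR hL] [hT hB]] := pg.
have hc : H x y <= 1.
  by have := near_parallelogram_center h (parallelogram_near (lexx 0) pg); rewrite addr0.
have [x0|x0] := lerP x 0; first exact: (half_chord_ge h a0 (lexx _) b0 hc hB hT hR hL x0 hr).
have h' := strong_convex_flip h.
apply: (half_chord_ge h' (x := - x) (y := y) (b := b) a0 (lexx _) b0) => //; rewrite ?opprD
  ?opprK //.
lra.
Qed.

(** * Perturbed gauges in rotated frames *)

(** The body need not be symmetric, hence [0 <= k] in the homogeneity. In the sum norm, [1 / m] is
    an outer and [1 / M] an inner radius of the body. *)
Record gauge (R : realType) (m M : R) (g : R -> R -> R) : Prop := Gauge {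
  gauge_gt0 : 0 < m;
  gauge_homo : forall k x y, 0 <= k -> g (k * x) (k * y) = k * g x y;
  gauge_sub : forall x y x' y', g (x + x') (y + y') <= g x y + g x' y';
  gauge_lower : forall x y, m * (`|x| + `|y|) <= g x y;
  gauge_upper : forall x y, g x y <= M * (`|x| + `|y|) }.

Definition perturb (R : realType) (e : R) (g : R -> R -> R) (x y : R) : R :=
  g x y + e * (x ^+ 2 + y ^+ 2).

(** Coordinates along the unit vectors of angles [th] and [th + al], in general oblique. *)
Definition frame (R : realType) (al th : R) (h : R -> R -> R) (x y : R) : R :=
  h (x * cos th + y * cos (th + al)) (x * sin th + y * sin (th + al)).

Lemma gauge_upper_ge0 (R : realType) (m M : R) g : gauge m M g -> 0 <= M.
Proof.
move=> G; have := le_trans (gauge_lower G 1 0) (gauge_upper G 1 0).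
rewrite normr1 normr0 addr0 !mulr1; have := gauge_gt0 G; lra.
Qed.

Lemma perturb_bound (R : realType) (m M e : R) g (x y : R) : gauge m M g -> 0 <= e ->
  perturb e g x y <= 1 -> `|x| + `|y| <= m^-1.
Proof.
move=> G e0 h; have m0 := gauge_gt0 G.
rewrite -(ler_pM2l m0) mulfV ?gt_eqF //.
apply: (le_trans (gauge_lower G x y)); apply: le_trans h; rewrite /perturb lerDl.
by rewrite mulr_ge0 // addr_ge0 ?sqr_ge0.
Qed.

Lemma perturb_lip (R : realType) (m M e : R) g (x y x' y' : R) : gauge m M g -> 0 <= e ->
  perturb e g x y - perturb e g x' y' <=
  (M + e * (`|x| + `|y| + `|x'| + `|y'|)) * (`|x - x'| + `|y - y'|).
Proof.
move=> G e0; rewrite /perturb.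
have A : g x y <= g x' y' + M * (`|x - x'| + `|y - y'|).
  have := gauge_sub G x' y' (x - x') (y - y'); rewrite !subrKC => /le_trans; apply.
  by rewrite lerD2l (gauge_upper G).
have sq (u v : R) : u ^+ 2 - v ^+ 2 <= `|u - v| * (`|u| + `|v|).
  have -> : u ^+ 2 - v ^+ 2 = (u - v) * (u + v) by ring.
  by rewrite (le_trans (ler_norm _)) // normrM ler_wpM2l // ler_normD.
have B := sq x x'; have C := sq y y'.
have D : e * (x ^+ 2 + y ^+ 2) - e * (x' ^+ 2 + y' ^+ 2) <=
   e * (`|x - x'| * (`|x| + `|x'|) + `|y - y'| * (`|y| + `|y'|)).
  rewrite -mulrBr ler_wpM2l //; lra.
have E : e * (`|x - x'| * (`|x| + `|x'|) + `|y - y'| * (`|y| + `|y'|)) <=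
   e * ((`|x| + `|y| + `|x'| + `|y'|) * (`|x - x'| + `|y - y'|)).
  rewrite ler_wpM2l //.
  have := normr_ge0 x; have := normr_ge0 y; have := normr_ge0 x'; have := normr_ge0 y'.
  have := normr_ge0 (x - x'); have := normr_ge0 (y - y').
  move: `|x - x'| `|y - y'| `|x| `|y| `|x'| `|y'|; clear => a b c d c' d' *.
  have -> : (c + d + c' + d') * (a + b) = a * (c + c') + b * (d + d') + (a * (d + d') + b * (c +
    c')) by ring.
  by rewrite lerDl addr_ge0 // mulr_ge0 // addr_ge0.
lra.
Qed.

Lemma norm_cos_lt1 (R : realType) (al : R) : sin al != 0 -> `|cos al| < 1.
Proof.
move=> s0; rewrite lt_neqAle cos_max andbT; apply/eqP => /cos1sin0 /eqP.
by rewrite (negbTE s0).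
Qed.

Lemma frame_inv (R : realType) (al th x y X Y : R) :
  X = x * cos th + y * cos (th + al) -> Y = x * sin th + y * sin (th + al) ->
  x * sin al = X * sin (th + al) - Y * cos (th + al) /\ y * sin al = Y * cos th - X * sin th.
Proof.
move=> -> ->; have c2 := cos2Dsin2 th.
rewrite sinD cosD; split.
  have -> : x * sin al = x * sin al * (cos th ^+ 2 + sin th ^+ 2) by rewrite c2 mulr1.
  by ring.
have -> : y * sin al = y * sin al * (cos th ^+ 2 + sin th ^+ 2) by rewrite c2 mulr1.
by ring.
Qed.

Lemma norm_mul_le (R : realType) (x c : R) : `|c| <= 1 -> `|x * c| <= `|x|.
Proof. by move=> c1; rewrite normrM ler_piMr. Qed.

Lemma frame_coord_bound (R : realType) (al th x y B : R) : sin al != 0 ->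
  `|x * cos th + y * cos (th + al)| + `|x * sin th + y * sin (th + al)| <= B ->
  `|x| <= B / `|sin al| /\ `|y| <= B / `|sin al|.
Proof.
move=> s0; have [E1 E2] := @frame_inv R al th x y _ _ erefl erefl.
move: E1 E2; set X := (_ + _ * cos _); set Y := (_ + _ * sin _) => E1 E2 le.
have s1 : 0 < `|sin al| by rewrite normr_gt0.
split; rewrite ler_pdivlMr // -normrM ?E1 ?E2 (le_trans (ler_normB _ _)) //.
  by apply: le_trans le; rewrite lerD // norm_mul_le ?sin_max ?cos_max.
by apply: le_trans le; rewrite addrC lerD // norm_mul_le ?sin_max ?cos_max.
Qed.

Lemma frame_norm_le (R : realType) (x y th th' : R) : `|x * cos th + y * cos th'| <= `|x| + `|y|
  /\
  `|x * sin th + y * sin th'| <= `|x| + `|y|.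
Proof.
by split; rewrite (le_trans (ler_normD _ _)) // lerD // norm_mul_le ?sin_max ?cos_max.
Qed.

(** For unit vectors [u], [v] at angle [al], the squared length of [x u + y v] is at least
    [(1 - |cos al|) * (x ^ 2 + y ^ 2)], which gives the modulus; the bound on the sublevel set is
    Cramer's rule with determinant [sin al]. No constant involves [th]. *)
Lemma strong_convex_frame (R : realType) (m M e al th : R) g : gauge m M g -> 0 < e ->
  sin al != 0 ->
  strong_convex (e * (1 - `|cos al|)) (2 * M + 4 * e) (m^-1 / `|sin al|) (frame al th (perturb e
    g)).
Proof.
move=> G e0 s0; have c1 := norm_cos_lt1 s0; have M0 := gauge_upper_ge0 G; split.
- by rewrite mulr_gt0 // subr_gt0.
- move=> t x y x' y' t0 t1.
  rewrite /frame.
  set X := x * cos th + y * cos (th + al); set Y := x * sin th + y * sin (th + al).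
  set X' := x' * cos th + y' * cos (th + al); set Y' := x' * sin th + y' * sin (th + al).
  have -> : ((1 - t) * x + t * x') * cos th + ((1 - t) * y + t * y') * cos (th + al) = (1 - t) *
    X + t * X'.
    by rewrite /X /X'; ring.
  have -> : ((1 - t) * x + t * x') * sin th + ((1 - t) * y + t * y') * sin (th + al) = (1 - t) *
    Y + t * Y'.
    by rewrite /Y /Y'; ring.
  have A : g ((1 - t) * X + t * X') ((1 - t) * Y + t * Y') <= (1 - t) * g X Y + t * g X' Y'.
    by apply: (le_trans (gauge_sub G _ _ _ _)); rewrite !(gauge_homo G) // subr_ge0.
  have B : (1 - `|cos al|) * ((x - x') ^+ 2 + (y - y') ^+ 2) <= (X - X') ^+ 2 + (Y - Y') ^+ 2.
    have -> : (X - X') ^+ 2 + (Y - Y') ^+ 2 =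
      (x - x') ^+ 2 + (y - y') ^+ 2 + 2 * ((x - x') * (y - y')) * cos al.
      have cc : cos al = cos (th + al) * cos th + sin (th + al) * sin th.
        by rewrite -cosB addrC addKr.
      have c2 := cos2Dsin2 th; have c3 := cos2Dsin2 (th + al).
      transitivity ((x - x') ^+ 2 * (cos th ^+ 2 + sin th ^+ 2) +
         (y - y') ^+ 2 * (cos (th + al) ^+ 2 + sin (th + al) ^+ 2) + 2 * ((x - x') * (y - y')) *
           cos al).
        by rewrite cc /X /X' /Y /Y'; ring.
      by rewrite c2 c3 !mulr1.
    set p := x - x'; set q := y - y'.
    have [k0 k1] : - `|cos al| <= cos al /\ cos al <= `|cos al|.
      by have := lexx `|cos al|; rewrite {1}ler_norml => /andP.
    have p2 := sqr_ge0 (p + q); have q2 := sqr_ge0 (p - q).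
    have : 0 <= (p + q) ^+ 2 * (`|cos al| + cos al) by rewrite mulr_ge0 //; lra.
    have : 0 <= (p - q) ^+ 2 * (`|cos al| - cos al) by rewrite mulr_ge0 //; lra.
    by clear; lra.
  rewrite /perturb.
  have C : 0 <= e * t * (1 - t) by rewrite !mulr_ge0 ?(ltW e0) // subr_ge0.
  have := ler_wpM2l C B.
  by move: A; clear; lra.
- move=> x y x' y'; rewrite /frame.
  apply: (le_trans (perturb_lip _ _ _ _ G (ltW e0))).
  set X := x * cos th + y * cos (th + al); set Y := x * sin th + y * sin (th + al).
  set X' := x' * cos th + y' * cos (th + al); set Y' := x' * sin th + y' * sin (th + al).
  have [a1 a2] := frame_norm_le x y th (th + al).
  have [b1 b2] := frame_norm_le x' y' th (th + al).
  have [d1 d2] := frame_norm_le (x - x') (y - y') th (th + al).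
  have E1 : `|X - X'| + `|Y - Y'| <= 2 * (`|x - x'| + `|y - y'|).
    have -> : X - X' = (x - x') * cos th + (y - y') * cos (th + al) by rewrite /X /X'; ring.
    have -> : Y - Y' = (x - x') * sin th + (y - y') * sin (th + al) by rewrite /Y /Y'; ring.
    by move: d1 d2; clear; lra.
  apply: (@le_trans _ _ ((M + e * (`|X| + `|Y| + `|X'| + `|Y'|)) * (2 * (`|x - x'| + `|y -
    y'|)))).
    by rewrite ler_wpM2l // addr_ge0 // mulr_ge0 ?(ltW e0) // !addr_ge0.
  rewrite mulrCA mulrA ler_wpM2r ?addr_ge0 //.
  have S : `|X| + `|Y| + `|X'| + `|Y'| <= 2 * (`|x| + `|y| + `|x'| + `|y'|).
    by move: a1 a2 b1 b2; rewrite -/X -/Y -/X' -/Y'; clear; lra.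
  have := ler_wpM2l (ltW e0) S.
  have : 0 <= M * (`|x| + `|y| + `|x'| + `|y'|) by rewrite mulr_ge0 // !addr_ge0.
  have Se : 0 <= e * (`|x| + `|y| + `|x'| + `|y'|) by rewrite mulr_ge0 ?(ltW e0) // !addr_ge0.
  move: M0 e0 Se; clear.
  lra.
- rewrite /frame /perturb !mul0r addr0 expr0n /= addr0 mulr0 addr0.
  have := gauge_upper G 0 0; have := gauge_lower G 0 0.
  by rewrite normr0 addr0 !mulr0; lra.
- move=> x y /(perturb_bound G (ltW e0)) le; exact: frame_coord_bound le.
Qed.

(** The constant [rho] satisfies [rho * (2 * M + 2 * e) < 1], and its summand 2 gives [rho <= 1],
    hence [rho ^ 2 <= rho] in the quadratic term. *)
Lemma perturb_axis_lt1 (R : realType) (m M e u v : R) g : gauge m M g -> 0 < e ->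
  `|u| <= 1 -> `|v| <= 1 ->
  perturb e g ((4 * M + 4 * e + 2)^-1 * u) ((4 * M + 4 * e + 2)^-1 * v) < 1.
Proof.
move=> G e0 u1 v1; set rho := _^-1; have M0 := gauge_upper_ge0 G.
have d0 : 0 < 4 * M + 4 * e + 2 by lra.
have r0 : 0 < rho by rewrite invr_gt0.
have rE : rho * (4 * M + 4 * e + 2) = 1 by rewrite mulVf // gt_eqF.
have Mr : 0 <= M * rho by rewrite mulr_ge0 // ltW.
have er : 0 <= e * rho by rewrite mulr_ge0 ?ltW.
have r1 : rho <= 1 by lra.
rewrite /perturb (gauge_homo G) ?(ltW r0) //.
have u2 : u ^+ 2 <= 1 by move: u1; rewrite ler_norml; clear => /andP[? ?]; nra.
have v2 : v ^+ 2 <= 1 by move: v1; rewrite ler_norml; clear => /andP[? ?]; nra.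
have A : rho * g u v <= rho * (M * 2).
  rewrite ler_pM2l // (le_trans (gauge_upper G u v)) // ler_wpM2l //; lra.
have B : e * ((rho * u) ^+ 2 + (rho * v) ^+ 2) <= e * (rho * 2).
  rewrite ler_pM2l // !exprMn -mulrDr.
  apply: (@le_trans _ _ (rho ^+ 2 * 2)); first by rewrite ler_wpM2l ?sqr_ge0 //; lra.
  by rewrite ler_wpM2r // expr2 ler_piMr // ltW.
lra.
Qed.

(** * Inscribed parallelograms as functions of their direction *)

Lemma cos_sin_lip (R : realType) (x y : R) :
  `|cos x - cos y| <= `|x - y| /\ `|sin x - sin y| <= `|x - y|.
Proof.
wlog xy : x y / y <= x.
  move=> wl; case/orP: (le_total y x) => xy; first exact: wl.
  by rewrite distrC (distrC (sin x)) (distrC x); exact: wl.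
split.
  have [|c _ ->] := @MVT_segment R cos (fun t => - sin t) y x xy (fun t _ => is_derive_cos t).
    by apply: continuous_subspaceT => t; exact: continuous_cos.
  by rewrite normrM normrN ler_piMl // sin_max.
have [|c _ ->] := @MVT_segment R sin cos y x xy (fun t _ => is_derive_sin t).
  by apply: continuous_subspaceT => t; exact: continuous_sin.
by rewrite normrM ler_piMl // cos_max.
Qed.

(* Plane coordinates: center [(c1, c2)], half-diagonals of length [a] and [b] in the
   directions [th] and [th + al]. *)
Definition inscribed (R : realType) (al : R) (h : R -> R -> R) (th c1 c2 a b : R) : Prop :=
  [/\ 0 < a, 0 < b,
      h (c1 + a * cos th) (c2 + a * sin th) = 1 /\ h (c1 - a * cos th) (c2 - a * sin th) = 1 &
      h (c1 + b * cos (th + al)) (c2 + b * sin (th + al)) = 1 /\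
      h (c1 - b * cos (th + al)) (c2 - b * sin (th + al)) = 1].

Lemma inscribedE (R : realType) (al : R) h (th x y a b : R) :
  inscribed al h th (x * cos th + y * cos (th + al)) (x * sin th + y * sin (th + al)) a b <->
  parallelogram (frame al th h) x y a b.
Proof.
rewrite /inscribed /parallelogram /frame.
have E1 c c' : (x + a) * c + y * c' = x * c + y * c' + a * c by ring.
have E2 c c' : (x - a) * c + y * c' = x * c + y * c' - a * c by ring.
have E3 c c' : x * c + (y + b) * c' = x * c + y * c' + b * c' by ring.
have E4 c c' : x * c + (y - b) * c' = x * c + y * c' - b * c' by ring.
by rewrite !E1 !E2 !E3 !E4.
Qed.

Lemma frame_coordE (R : realType) (al th c1 c2 : R) : sin al != 0 ->
  exists x y, c1 = x * cos th + y * cos (th + al) /\ c2 = x * sin th + y * sin (th + al).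
Proof.
move=> s0.
exists ((c1 * sin (th + al) - c2 * cos (th + al)) / sin al), ((c2 * cos th - c1 * sin th) / sin
  al).
have sE : sin al = sin (th + al) * cos th - cos (th + al) * sin th.
  by rewrite -sinB addrC addKr.
by split; apply: (mulIf s0); rewrite sE; field; rewrite -sE.
Qed.

Lemma parallelogram_swap (R : realType) (H : R -> R -> R) (x y a b : R) :
  parallelogram H x y a b -> parallelogram (fun x y => H y x) y x b a.
Proof. by case. Qed.

Lemma inscribed_exists (R : realType) (m M e al th : R) g : gauge m M g -> 0 < e ->
  sin al != 0 -> exists c1 c2 a b, inscribed al (perturb e g) th c1 c2 a b.
Proof.
move=> G e0 s0; have M0 := gauge_upper_ge0 G.
have h := strong_convex_frame th G e0 s0.
have r0 : 0 < (4 * M + 4 * e + 2)^-1 by rewrite invr_gt0; lra.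
have [||x [y [a [b pg]]]] := parallelogram_exists h r0.
- by rewrite /frame !mul0r !addr0; apply: (perturb_axis_lt1 G e0); rewrite ?cos_max ?sin_max.
- rewrite /frame !mul0r !addr0 !mulNr -!mulrN.
  by apply: (perturb_axis_lt1 G e0); rewrite normrN ?cos_max ?sin_max.
exists (x * cos th + y * cos (th + al)), (x * sin th + y * sin (th + al)), a, b.
exact/inscribedE.
Qed.

Lemma inscribed_big (R : realType) (m M e al th c1 c2 a b : R) g : gauge m M g -> 0 < e ->
  sin al != 0 -> inscribed al (perturb e g) th c1 c2 a b ->
  (4 * M + 4 * e + 2)^-1 <= 2 * a /\ (4 * M + 4 * e + 2)^-1 <= 2 * b.
Proof.
move=> G e0 s0; have [x [y [-> ->]]] := frame_coordE th c1 c2 s0.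
have h := strong_convex_frame th G e0 s0.
move=> /inscribedE pg; split.
  apply: (parallelogram_big h) pg; rewrite /frame !mul0r !addr0 ?mulNr -?mulrN;
  by apply: (perturb_axis_lt1 G e0); rewrite ?normrN ?cos_max ?sin_max.
apply: (parallelogram_big (strong_convex_swap h)) (parallelogram_swap pg);
  rewrite /frame !mul0r !add0r ?mulNr -?mulrN;
  by apply: (perturb_axis_lt1 G e0); rewrite ?normrN ?cos_max ?sin_max.
Qed.

Lemma parallelogram_le (R : realType) (e L D : R) H (h : strong_convex e L D H) (x y a b : R) :
  parallelogram H x y a b -> [/\ a <= D, b <= D, `|x| <= D & `|y| <= D].
Proof.
case=> a0 b0 [hR hL] [hT hB].
have [r1 _] := sc_bnd h (ltac:(by rewrite hR) : H (x + a) y <= 1).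
have [r2 _] := sc_bnd h (ltac:(by rewrite hL) : H (x - a) y <= 1).
have [_ r3] := sc_bnd h (ltac:(by rewrite hT) : H x (y + b) <= 1).
have [_ r4] := sc_bnd h (ltac:(by rewrite hB) : H x (y - b) <= 1).
move: r1 r2 r3 r4; rewrite !ler_norml; clear -a0 b0 => /andP[? ?] /andP[? ?] /andP[? ?] /andP[?
  ?].
by split; try (apply/andP; split); lra.
Qed.

Lemma inscribed_le (R : realType) (m M e al th c1 c2 a b : R) g : gauge m M g -> 0 < e ->
  sin al != 0 -> inscribed al (perturb e g) th c1 c2 a b ->
  [/\ `|c1| + `|c2| <= m^-1, a <= m^-1 / `|sin al| & b <= m^-1 / `|sin al|].
Proof.
move=> G e0 s0; have [x [y [-> ->]]] := frame_coordE th c1 c2 s0.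
have h := strong_convex_frame th G e0 s0.
move=> /inscribedE pg; have [? ? _ _] := parallelogram_le h pg; split => //.
apply: (perturb_bound G (ltW e0)).
by have := near_parallelogram_center h (parallelogram_near (lexx 0) pg); rewrite addr0.
Qed.

Lemma perturb_rotate (R : realType) (m M e B c1 c2 s th th' : R) g : gauge m M g -> 0 < e ->
  `|c1| + `|c2| + `|s| <= B ->
  `|perturb e g (c1 + s * cos th) (c2 + s * sin th) -
    perturb e g (c1 + s * cos th') (c2 + s * sin th')| <= (M + e * (4 * B)) * (2 * B) * `|th' -
      th|.
Proof.
move=> G e0 hB; have M0 := gauge_upper_ge0 G.
have B0 : 0 <= B by apply: le_trans hB; rewrite !addr_ge0.
have n1 := normr_ge0 c1; have n2 := normr_ge0 c2; have n3 := normr_ge0 s.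
have bd u v : `|u| <= `|c1| + `|c2| -> `|v| <= 1 -> `|u + s * v| <= B.
  move=> hu hv; apply: le_trans hB; rewrite (le_trans (ler_normD _ _)) // lerD //.
  exact: norm_mul_le.
have one t t' : perturb e g (c1 + s * cos t) (c2 + s * sin t) -
    perturb e g (c1 + s * cos t') (c2 + s * sin t') <= (M + e * (4 * B)) * (2 * B) * `|t' - t|.
  apply: (le_trans (perturb_lip _ _ _ _ G (ltW e0))).
  have b1 : `|c1 + s * cos t| <= B by apply: bd; [lra | exact: cos_max].
  have b2 : `|c2 + s * sin t| <= B by apply: bd; [lra | exact: sin_max].
  have b3 : `|c1 + s * cos t'| <= B by apply: bd; [lra | exact: cos_max].
  have b4 : `|c2 + s * sin t'| <= B by apply: bd; [lra | exact: sin_max].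
  rewrite -mulrA; apply: ler_pM.
  - by rewrite addr_ge0 // mulr_ge0 ?(ltW e0) // !addr_ge0.
  - by rewrite addr_ge0.
  - by rewrite lerD2l ler_pM2l //; lra.
  have -> : c1 + s * cos t - (c1 + s * cos t') = s * (cos t - cos t') by ring.
  have -> : c2 + s * sin t - (c2 + s * sin t') = s * (sin t - sin t') by ring.
  have [d1 d2] := cos_sin_lip t t'; rewrite (distrC t) in d1 d2.
  have sB : `|s| <= B by lra.
  have := ler_pM (normr_ge0 s) (normr_ge0 _) sB d1; have := ler_pM (normr_ge0 s) (normr_ge0 _)
    sB d2.
  by rewrite -!normrM; clear; lra.
by rewrite ler_norml lerNl opprB one andbT (distrC th'); exact: one.
Qed.

(** The parallelogram of direction [th'], turned about its center to direction [th], is inscribed up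
    to a defect [K * |th' - th|], and [parallelogram_stable] in the frame of [th] bounds all data by
    this defect. The case [th = th'] is uniqueness. *)
Lemma inscribed_lipschitz (R : realType) (m M e al : R) g : gauge m M g -> 0 < e ->
  sin al != 0 -> exists2 C, 0 <= C & forall th th' c1 c2 a b c1' c2' a' b',
    inscribed al (perturb e g) th c1 c2 a b -> inscribed al (perturb e g) th' c1' c2' a' b' ->
    [/\ `|c1' - c1| <= C * `|th' - th|, `|c2' - c2| <= C * `|th' - th|,
        `|a' - a| <= C * `|th' - th| & `|b' - b| <= C * `|th' - th|].
Proof.
move=> G e0 s0; have M0 := gauge_upper_ge0 G; have m0 := gauge_gt0 G.
have c0 : 0 < e * (1 - `|cos al|) by rewrite mulr_gt0 // subr_gt0 norm_cos_lt1.
pose r := (4 * M + 4 * e + 2)^-1 / 2.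
have r0 : 0 < r by rewrite divr_gt0 // invr_gt0; lra.
pose D := m^-1 / `|sin al|.
have D0 : 0 < D by rewrite divr_gt0 ?invr_gt0 // normr_gt0.
have mi0 : 0 < m^-1 by rewrite invr_gt0.
have [C C0 stab] := parallelogram_stable (2 * M + 4 * e) D c0 r0 (ltac:(lra) : r <= D + r).
pose B := m^-1 + D.
pose K := (M + e * (4 * B)) * (2 * B).
have K0 : 0 <= K.
  by rewrite /K mulr_ge0 ?addr_ge0 ?mulr_ge0 ?(ltW e0) // /B; lra.
have CK0 : 0 <= C * K by apply: mulr_ge0.
exists (2 * (C * K)); first by rewrite mulr_ge0.
move=> th th' c1 c2 a b c1' c2' a' b' ins ins'.
have [ca _ _] := inscribed_le G e0 s0 ins; have [ca' aD' bD'] := inscribed_le G e0 s0 ins'.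
have [ra rb] := inscribed_big G e0 s0 ins; have [ra' rb'] := inscribed_big G e0 s0 ins'.
have [a0' b0' [hR hL] [hT hB]] := ins'.
have near' u v w : `|w| <= D -> perturb e g (c1' + w * cos (th' + u)) (c2' + w * sin (th' + u))
  = 1 ->
    `|perturb e g (c1' + w * cos (th + u)) (c2' + w * sin (th + u)) - 1| <= K * `|th' - th|.
  move=> wD <-; have -> : th' - th = th' + u - (th + u) by ring.
  by apply: (perturb_rotate _ _ G e0); rewrite /B; lra.
rewrite -/D in aD' bD'.
have rE : (4 * M + 4 * e + 2)^-1 = 2 * r by rewrite /r; lra.
rewrite rE in ra rb ra' rb'.
have [x [y [E1 E2]]] := frame_coordE th c1 c2 s0.
have [x' [y' [E1' E2']]] := frame_coordE th c1' c2' s0.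
have h := strong_convex_frame th G e0 s0.
have bp : bounded_parallelogram r (D + r) x y a b.
  have [aD bD xD yD] : [/\ a <= D, b <= D, `|x| <= D & `|y| <= D].
    by apply: (parallelogram_le h); apply/inscribedE; rewrite -E1 -E2.
  by split; move: aD bD xD yD ra rb r0; clear; lra.
have bp' : bounded_parallelogram r (D + r) x' y' a' b'.
  have [xD yD] : `|x'| <= D /\ `|y'| <= D.
    by apply: (frame_coord_bound (th := th) s0); rewrite -E1' -E2'.
  by split; move: aD' bD' xD yD ra' rb' r0; clear; lra.
have n0 : 0 <= K * `|th' - th| by rewrite mulr_ge0.
have np : near_parallelogram (K * `|th' - th|) (frame al th (perturb e g)) x y a b.
  by apply: parallelogram_near => //; apply/inscribedE; rewrite -E1 -E2.
have np' : near_parallelogram (K * `|th' - th|) (frame al th (perturb e g)) x' y' a' b'.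
  have F1 w : frame al th (perturb e g) (x' + w) y' = perturb e g (c1' + w * cos (th + 0)) (c2'
    + w * sin (th + 0)).
    by rewrite /frame E1' E2' addr0; congr (perturb _ _ _ _); ring.
  have F2 w : frame al th (perturb e g) x' (y' + w) = perturb e g (c1' + w * cos (th + al)) (c2'
    + w * sin (th + al)).
    by rewrite /frame E1' E2'; congr (perturb _ _ _ _); ring.
  split; rewrite ?F1 ?F2; apply: near'; rewrite ?normrN ?gtr0_norm ?addr0 ?mulNr //.
have [d1 d2 d3 d4] := stab _ h _ _ _ _ _ _ _ _ _ n0 bp bp' np np'.
have fin z : `|z| <= C * (K * `|th' - th|) -> `|z| <= 2 * (C * K) * `|th' - th|.
  by move=> /le_trans; apply; have := mulr_ge0 CK0 (normr_ge0 (th' - th)); clear; lra.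
split; [| | exact: fin | exact: fin].
- have -> : c1' - c1 = (x' - x) * cos th + (y' - y) * cos (th + al) by rewrite E1 E1'; ring.
  have [le _] := frame_norm_le (x' - x) (y' - y) th (th + al).
  by apply: (le_trans le); move: d1 d2; clear; lra.
- have -> : c2' - c2 = (x' - x) * sin th + (y' - y) * sin (th + al) by rewrite E2 E2'; ring.
  have [_ le] := frame_norm_le (x' - x) (y' - y) th (th + al).
  by apply: (le_trans le); move: d1 d2; clear; lra.
Qed.

(** * Calculus *)

Lemma is_derive_epsP (R : realType) (f : R -> R) (x l : R) :
  is_derive x 1 f l <->
  forall k, 0 < k -> exists2 d, 0 < d &
    forall y, `|y - x| < d -> `|f y - f x - l * (y - x)| <= k * `|y - x|.
Proof.
have qE h : h != 0 -> `|l - h^-1 *: ((f \o shift x) (h *: 1) - f x)| =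
    `|f (h + x) - f x - l * h| / `|h|.
  move=> h0; rewrite -normfV -normrM -normrN; congr `|_|.
  by rewrite /= /GRing.scale /= mulr1; field.
split.
  move=> [dv lE] k k0.
  have : h^-1 *: ((f \o shift x) (h *: 1) - f x) @[h --> 0^'] --> l by rewrite -lE; exact: dv.
  move=> /cvgrPdist_le /(_ _ k0) /nbhs_ballP [d /= d0 hd]; exists d => // y yd.
  have [->|yx] := eqVneq y x; first by rewrite !subrr mulr0 subr0 normr0 mulr0.
  have yx0 : y - x != 0 by rewrite subr_eq0.
  have := hd (y - x); rewrite /ball /= sub0r normrN => /(_ yd yx0).
  by rewrite qE // subrK ler_pdivrMr // normr_gt0.
move=> H.
have C : h^-1 *: ((f \o shift x) (h *: 1) - f x) @[h --> 0^'] --> l.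
  apply/cvgrPdist_le => k k0; have [d d0 hd] := H k k0.
  apply/nbhs_ballP; exists d => // h; rewrite /ball /= sub0r normrN => hd' h0.
  rewrite qE // ler_pdivrMr ?normr_gt0 //.
  by have := hd (h + x); rewrite addrK; apply.
by apply: DeriveDef; [apply/cvg_ex; exists l | exact: cvg_lim].
Qed.

Lemma antiderivative_right (R : realType) (f : R -> R) : continuous f ->
  exists F : R -> R, forall x : R, 0 <= x -> is_derive x 1 F (f x).
Proof.
move=> fc; exists (fun x => (\int[lebesgue_measure]_(t in `[(-1)%R, x]) f t)%R) => x x0.
have [||||dv dE] := @continuous_FTC1_closed R f (-1) x (x + 1).
- by rewrite ltrDl.
- apply: continuous_compact_integrable; first exact: segment_compact.
  exact: continuous_subspaceT.
- lra.
- exact: fc.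
by apply: DeriveDef; [exact: dv | rewrite -derive1E].
Qed.

Lemma antiderivative (R : realType) (f : R -> R) : continuous f ->
  exists F : R -> R, forall x : R, is_derive x 1 F (f x).
Proof.
move=> fc; have [A dA] := antiderivative_right fc.
have [|B dB] := @antiderivative_right R (fun x => f (- x)).
  by move=> x; apply: continuous_comp; [exact: oppr_continuous | exact: fc].
(* Both pieces extend to 0 with value 0 and derivative [f 0], so they can be glued there. *)
pose S x := if 0 <= x then A x - A 0 else B 0 - B (- x).
exists S => x; apply/is_derive_epsP => k k0.
have S0 : S 0 = 0 by rewrite /S lexx subrr.
have [x0|x0|x0] := ltgtP x 0.
- have := dB (- x) (ltac:(lra)); rewrite /= opprK => /is_derive_epsP /(_ _ k0) [d d0 hd].
  exists (Num.min d (- x)); first by rewrite lt_min d0; lra.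
  move=> y; rewrite lt_min => /andP[yd yx].
  have y0 : y < 0 by move: yx; rewrite ltr_norml; lra.
  rewrite /S (leNgt 0 x) (leNgt 0 y) x0 y0 /=.
  have E : - y - - x = - (y - x) by ring.
  have := hd (- y); rewrite E normrN => /(_ yd).
  have -> : B 0 - B (- y) - (B 0 - B (- x)) - f x * (y - x) =
    - (B (- y) - B (- x) - f x * - (y - x)) by ring.
  by rewrite normrN.
- have := dA x (ltW x0); move=> /is_derive_epsP /(_ _ k0) [d d0 hd].
  exists (Num.min d x); first by rewrite lt_min d0; lra.
  move=> y; rewrite lt_min => /andP[yd yx].
  have y0 : 0 < y by move: yx; rewrite ltr_norml; lra.
  rewrite /S (ltW x0) (ltW y0).
  have -> : A y - A 0 - (A x - A 0) = A y - A x by ring.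
  exact: hd.
- rewrite x0 S0.
  have /is_derive_epsP /(_ _ k0) [d d0 hd] := dA 0 (lexx _).
  have /is_derive_epsP := dB 0 (lexx _).
  rewrite /= oppr0 => /(_ _ k0) [d' d0' hd'].
  exists (Num.min d d'); first by rewrite lt_min d0.
  move=> y; rewrite !addr0 lt_min => /andP[yd yd'].
  rewrite /S; case: ifP => y0; first by have := hd y; rewrite !subr0; apply.
  have := hd' (- y); rewrite !addr0 !normrN => /(_ yd').
  have -> : B 0 - B (- y) - f 0 * y = - (B (- y) - B 0 - f 0 * - y) by ring.
  by rewrite normrN.
Qed.

(** * Polar coordinates and sector areas *)

Definition radial (R : realType) (H : R -> R -> R) (t : R) : R := exit H 0 0 (cos t) (sin t).

(** The angle [t] is a real number, not a class modulo [2 * pi]: a boundary point has many angles,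
    and swept areas are differences of one antiderivative on the line. *)
Definition on_ray (R : realType) (H : R -> R -> R) (t x y : R) : Prop :=
  x = radial H t * cos t /\ y = radial H t * sin t.

Lemma direction_gt0 (R : realType) (t : R) : 0 < `|cos t| + `|sin t|.
Proof.
rewrite lt0r addr_ge0 // andbT paddr_eq0 // !normr_eq0; apply/negP => /andP[/eqP c0 /eqP s0].
by have := cos2Dsin2 t; rewrite c0 s0 expr0n /= addr0 => /eqP; rewrite eq_sym oner_eq0.
Qed.

Lemma radialP (R : realType) (e L D : R) H (h : strong_convex e L D H) (t : R) :
  0 < radial H t /\ H (radial H t * cos t) (radial H t * sin t) = 1.
Proof.
have := exitP h (_ : H 0 0 < 1) (direction_gt0 t).
by rewrite !add0r (sc_0 h); apply; exact: ltr01.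
Qed.

Lemma on_rayP (R : realType) (e L D : R) H (h : strong_convex e L D H) (r t x y : R) :
  0 < r -> x = r * cos t -> y = r * sin t -> H x y = 1 -> on_ray H t x y.
Proof.
move=> r0 -> -> hxy.
suff rE : r = radial H t by rewrite /on_ray -rE.
apply: (exit_unique h) => //; [by rewrite (sc_0 h) ltr01 | exact: direction_gt0 | by rewrite
  !add0r].
Qed.

Lemma radial_continuous (R : realType) (e L D : R) H (h : strong_convex e L D H) :
  continuous (radial H).
Proof.
move=> t; apply: (exit_cvg h); [exact: cvg_cst | exact: cvg_cst | exact: continuous_cos |
  exact: continuous_sin | by rewrite (sc_0 h) ltr01 | exact: direction_gt0].
Qed.

Lemma polar_right (R : realType) (u v : R) : 0 < u ->
  let t := atan (v / u) in
  [/\ - (pi / 2) < t < pi / 2, 0 < u / cos t, u = u / cos t * cos t & v = u / cos t * sin t].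
Proof.
move=> u0 t; have [tb tt] := atan_def (v / u); have c0 := cos_gt0_pihalf tb.
have cN : cos t != 0 by rewrite gt_eqF.
split => //; first by rewrite divr_gt0.
  by rewrite divfK.
have : tan t = v / u by exact: tt.
rewrite /tan => E; have -> : v = v / u * u by rewrite divfK // gt_eqF.
by rewrite -E; ring.
Qed.

Lemma polar_exists (R : realType) (x y : R) : ~ (x = 0 /\ y = 0) ->
  exists r t, [/\ 0 < r, - (pi / 2) <= t, t < - (pi / 2) + pi *+ 2, x = r * cos t & y = r * sin
    t].
Proof.
move=> xy; have p0 := pi_gt0 R.
have pE : (pi : R) *+ 2 = 2 * pi by rewrite mulr_natl.
have [x0|x0|x0] := ltgtP x 0.
- have [/andP[t1 t2] r0 uE vE] := @polar_right R (- x) (- y) (ltac:(lra)).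
  set t := atan _ in t1 t2 r0 uE vE *.
  exists (- x / cos t), (t + pi); split => //; rewrite ?pE; [lra | lra | |].
    by rewrite cosDpi mulrN -uE opprK.
  by rewrite sinDpi mulrN -vE opprK.
- have [/andP[t1 t2] r0 uE vE] := @polar_right R x y x0.
  set t := atan _ in t1 t2 r0 uE vE *.
  exists (x / cos t), t; split => //; rewrite ?pE; [exact: ltW | lra].
- have [y0|y0|y0] := ltgtP y 0.
  + exists (- y), (- (pi / 2)); rewrite cosN sinN cos_pihalf sin_pihalf pE; split => //; try lra.
  + exists y, (pi / 2); rewrite cos_pihalf sin_pihalf pE; split => //; try lra.
  + by exfalso; apply: xy.
Qed.

Lemma curve_on_ray (R : realType) (e L D : R) H (h : strong_convex e L D H) (x y : R) :
  H x y = 1 -> exists2 t, - (pi / 2) <= t < - (pi / 2) + pi *+ 2 & on_ray H t x y.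
Proof.
move=> hxy; have [|r [t [r0 t1 t2 xE yE]]] := @polar_exists R x y.
  by move=> [x0 y0]; move: hxy; rewrite x0 y0 (sc_0 h) => /eqP; rewrite eq_sym oner_eq0.
by exists t; [rewrite t1 t2 | exact: (on_rayP h r0)].
Qed.

Lemma on_ray_inj (R : realType) (e L D : R) H (h : strong_convex e L D H) (t t' x y : R) :
  on_ray H t x y -> on_ray H t' x y -> cos t = cos t' /\ sin t = sin t'.
Proof.
move=> [xE yE] [xE' yE']; have [r0 _] := radialP h t; have [r0' _] := radialP h t'.
have sq s : x = radial H s * cos s -> y = radial H s * sin s -> x ^+ 2 + y ^+ 2 = radial H s ^+ 2.
  by move=> -> ->; rewrite !exprMn -mulrDr cos2Dsin2 mulr1.
have rE : radial H t = radial H t'.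
  apply/eqP; rewrite -(@eqrXn2 _ 2) //; try exact: ltW.
  by rewrite -(sq t) // -(sq t').
have rN : radial H t != 0 by rewrite gt_eqF.
by split; apply: (mulfI rN); [rewrite -xE rE | rewrite -yE rE].
Qed.

(** If [a < b], then [(b - a) / 2] lies strictly between 0 and [pi] and has positive sine, whereas
    [cos (b - a) = 1] makes this sine vanish. *)
Lemma angle_unique (R : realType) (a b : R) : 0 < a -> a < pi *+ 2 -> 0 < b -> b < pi *+ 2 ->
  cos a = cos b -> sin a = sin b -> a = b.
Proof.
wlog ab : a b / a <= b.
  move=> wl a0 a1 b0 b1 c s; case/orP: (le_total a b) => ab; first exact: wl.
  by apply/esym; apply: wl => //.
move=> a0 a1 b0 b1 ca sa; apply/eqP; rewrite eq_le ab /= leNgt; apply/negP => lt.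
have s0 : 0 < sin ((b - a) / 2).
  by apply: sin_gt0_pi; move: b1; rewrite mulr2n; clear -lt a0; lra.
have : cos (b - a) = 1.
  by rewrite cosB ca sa -!expr2 cos2Dsin2.
have -> : b - a = ((b - a) / 2) *+ 2 by rewrite -mulr_natr divfK.
rewrite cos_mulr2n => E.
have := cos2Dsin2 ((b - a) / 2); have : 0 < sin ((b - a) / 2) ^+ 2 by rewrite exprn_gt0.
by move: E; rewrite mulr2n; clear; lra.
Qed.

Lemma atan_le (R : realType) (z : R) : `|atan z| <= `|z|.
Proof.
have pos (w : R) : 0 <= w -> `|atan w| <= w.
  move=> w0.
  have [|c _] := @MVT_segment R atan (fun t => (1 + t ^+ 2)^-1) 0 w w0 (fun t _ =>
    is_derive1_atan t).
    by apply: continuous_subspaceT => t; exact: continuous_atan.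
  rewrite atan0 !subr0 => ->; rewrite normrM (ger0_norm w0) ler_piMl //.
  rewrite normfV; have c1 : 1 <= 1 + c ^+ 2 by rewrite lerDl sqr_ge0.
  by rewrite ger0_norm ?(le_trans ler01) // invf_le1 // (lt_le_trans ltr01).
have [z0|z0] := ger0P z; first exact: pos.
by rewrite -normrN -atanN pos // oppr_ge0 ltW.
Qed.

(** The swept area is expanded to first order without differentiating the boundary. In coordinates
    [(u, v)] turned by [- t0], the cross product is [r * v = r * radial H (t0 + b) * sin b], while
    [S] grows by [r ^ 2 * b] up to [o(b)]. Continuity of [radial] makes the two agree to first
    order, and [b] is bounded by a multiple of the displacement. *)
Lemma ray_local (R : realType) (e L D : R) H (h : strong_convex e L D H) (S : R -> R)
  (dS : forall t : R, is_derive t 1 S (radial H t ^+ 2)) (t0 x0 y0 : R) : on_ray H t0 x0 y0 ->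
  exists2 C, 0 <= C & forall k, 0 < k -> exists2 d, 0 < d & forall x y, H x y = 1 ->
    `|x - x0| + `|y - y0| < d -> exists t, [/\ on_ray H t x y,
      `|t - t0| <= C * (`|x - x0| + `|y - y0|) &
      `|S t - S t0 - (x0 * y - y0 * x)| <= k * (`|x - x0| + `|y - y0|)].
Proof.
move=> [x0E y0E]; have [r0 _] := radialP h t0.
have [r rE] : exists r, radial H t0 = r by exists (radial H t0).
rewrite rE in x0E y0E r0.
exists (2 / r); first by rewrite divr_ge0 // ltW.
move=> k k0; pose q := 1 + r + r ^+ 2.
have q0 : 0 < q by rewrite /q addr_gt0 ?exprn_gt0 // addr_gt0.
(* Three errors [k1 * |b|] with weights 1, [r] and [r ^ 2] have to fit into [k * E], given
   [|b| <= 2 / r * E]. *)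
pose k1 := k * r / (2 * q).
have k10 : 0 < k1 by rewrite divr_gt0 ?mulr_gt0.
have /is_derive_epsP /(_ _ k10) [d1 d10 hd1] := dS t0.
have /is_derive_epsP /(_ _ k10) [d2 d20 hd2] := is_derive_sin (0 : R).
have := @radial_continuous R e L D H h t0 => /cvgrPdist_le /(_ _ k10) /nbhs_ballP [d3 /= d30 hd3].
pose d := Num.min d1 (Num.min d2 d3).
have d0 : 0 < d by rewrite !lt_min d10 d20.
exists (Num.min (r / 2) (r / 2 * d)); first by rewrite lt_min !mulr_gt0 // divr_gt0.
move=> x y hxy; rewrite lt_min; set E := `|x - x0| + _ => /andP[E1 E2].
have E0 : 0 <= E by rewrite addr_ge0.
pose u := x * cos t0 + y * sin t0.
pose v := - x * sin t0 + y * cos t0.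
have c2 := cos2Dsin2 t0.
have uE : `|u - r| <= E.
  have -> : u - r = (x - x0) * cos t0 + (y - y0) * sin t0.
    rewrite -[r in LHS]mulr1 -c2 /u x0E y0E; ring.
  by rewrite (le_trans (ler_normD _ _)) // lerD // norm_mul_le ?cos_max ?sin_max.
have vE : `|v| <= E.
  have -> : v = - (x - x0) * sin t0 + (y - y0) * cos t0.
    by rewrite /v x0E y0E; ring.
  rewrite (le_trans (ler_normD _ _)) // lerD //; last by rewrite norm_mul_le ?cos_max.
  by rewrite mulNr normrN norm_mul_le ?sin_max.
have u0 : r / 2 < u by move: uE E1; rewrite ler_norml; clear -r0 => /andP[? ?] ?; lra.
have u0' : 0 < u by apply: lt_trans u0; rewrite divr_gt0.
have [_ rp uR vR] := polar_right v u0'; set b := atan (v / u) in rp uR vR.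
have bE : `|b| <= 2 / r * E.
  apply: (le_trans (atan_le _)); rewrite normrM normfV (gtr0_norm u0') ler_pdivrMr //.
  apply: (le_trans vE); rewrite mulrAC -[leLHS]mul1r ler_wpM2r //.
  rewrite mulrAC ler_pdivlMr // mul1r; lra.
have bd : `|b| < d.
  apply: (le_lt_trans bE); rewrite mulrC; have -> : d = (r / 2 * d) * (2 / r) by field; rewrite
    gt_eqF.
  by rewrite ltr_pM2r // divr_gt0.
exists (t0 + b); rewrite addrAC subrr add0r.
have xR : x = u / cos b * cos (t0 + b).
  rewrite cosD; transitivity (u * cos t0 - v * sin t0).
    by rewrite -[LHS]mulr1 -c2 /u /v; ring.
  by rewrite {1}uR {1}vR; ring.
have yR : y = u / cos b * sin (t0 + b).
  rewrite sinD; transitivity (u * sin t0 + v * cos t0).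
    by rewrite -[LHS]mulr1 -c2 /u /v; ring.
  by rewrite {1}uR {1}vR; ring.
have on := on_rayP h rp xR yR hxy.
split => //.
have -> : x0 * y - y0 * x = r * v by rewrite x0E y0E /v; ring.
have vS : v = radial H (t0 + b) * sin b.
  have [xS yS] := on; rewrite /v [in LHS]xS [in LHS]yS.
  have -> : sin b = sin (t0 + b - t0) by rewrite addrC addKr.
  by rewrite (sinB (t0 + b)); ring.
move: bd; rewrite !lt_min => /and3P[b1 b2 b3].
have F1 : `|S (t0 + b) - S t0 - r ^+ 2 * b| <= k1 * `|b|.
  by have := hd1 (t0 + b); rewrite (addrAC t0) subrr add0r rE; apply.
have F2 : `|sin b - b| <= k1 * `|b|.
  by have := hd2 b; rewrite sin0 cos0 !subr0 mul1r; apply.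
have F3 : `|r - radial H (t0 + b)| <= k1.
  by rewrite -rE; apply: hd3; rewrite /ball /= opprD addNKr normrN.
have F4 : `|sin b| <= `|b|.
  by have [_] := cos_sin_lip b 0; rewrite sin0 !subr0.
have -> : S (t0 + b) - S t0 - r * v = (S (t0 + b) - S t0 - r ^+ 2 * b) - r ^+ 2 * (sin b - b)
    + r * ((r - radial H (t0 + b)) * sin b).
  by rewrite vS; ring.
have G2 : `|r ^+ 2 * (sin b - b)| <= r ^+ 2 * (k1 * `|b|).
  by rewrite normrM ger0_norm ?sqr_ge0 // ler_wpM2l ?sqr_ge0.
have G3 : `|r * ((r - radial H (t0 + b)) * sin b)| <= r * (k1 * `|b|).
  by rewrite normrM (gtr0_norm r0) ler_pM2l // normrM ler_pM.
have G : k1 * q * `|b| <= k * E.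
  have -> : k * E = k1 * q * (2 / r * E).
    rewrite /k1; field; rewrite !gt_eqF //.
  by rewrite ler_wpM2l // mulr_ge0 // ltW.
apply: (le_trans (ler_normD _ _)); apply: le_trans (lerD (le_trans (ler_normB _ _) (lerD F1 G2))
  G3) _.
by apply: le_trans G; rewrite /q; clear; lra.
Qed.

(** The bounds on [t'] select the counterclockwise arc of less than a full turn, for any choice of
    the angle [t]. *)
Definition sector (R : realType) (H : R -> R -> R) (S : R -> R) (x y x' y' d : R) : Prop :=
  exists t t', [/\ on_ray H t x y, on_ray H t' x' y', t < t', t' < t + pi *+ 2 & d = S t' - S t].

(* Twice the area swept counterclockwise from [(x, y)] to [(x', y')], when [S' = radial ^ 2]. *)
Definition sector_area (R : realType) (H : R -> R -> R) (S : R -> R) (x y x' y' : R) : R :=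
  xget 0 (sector H S x y x' y').

(** The two pairs of angles differ by a common multiple of [2 * pi], but no integer has to be named:
    [F] is constant because [radial] agrees at [w + t] and [w + s], and it is evaluated at [w = 0]
    and [w = t' - t]. *)
Lemma sector_unique (R : realType) (e L D : R) H (h : strong_convex e L D H) (S : R -> R)
  (dS : forall t : R, is_derive t 1 S (radial H t ^+ 2)) (x y x' y' d d' : R) :
  sector H S x y x' y' d -> sector H S x y x' y' d' -> d = d'.
Proof.
move=> [t [t' [on on' lt lt' ->]]] [s [s' [os os' ls ls' ->]]].
have [ct st] := on_ray_inj h on os; have [ct' st'] := on_ray_inj h on' os'.
have E : t' - t = s' - s.
  apply: angle_unique; rewrite ?cosB ?sinB ?ct ?st ?ct' ?st' //; clear -lt lt' ls ls'; lra.
have rp w : radial H (w + t) = radial H (w + s).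
  by rewrite /radial !cosD !sinD ct st.
pose F w := S (w + t) - S (w + s).
have dS' (c w : R) : is_derive w 1 (fun w => S (w + c)) (radial H (w + c) ^+ 2).
  apply/is_derive_epsP => k k0.
  have /is_derive_epsP /(_ _ k0) [r r0 hr] := dS (w + c); exists r => // z zr.
  have E' : z + c - (w + c) = z - w by ring.
  by have := hr (z + c); rewrite E'; apply.
have dF (w : R) : is_derive w 1 F 0.
  have -> : 0 = radial H (w + t) ^+ 2 - radial H (w + s) ^+ 2 by rewrite rp subrr.
  exact: is_deriveB.
have := is_derive_0_is_cst (t' - t) 0 dF.
by rewrite /F subrK E subrK !add0r; lra.
Qed.

Lemma sector_exists (R : realType) (e L D : R) H (h : strong_convex e L D H) (S : R -> R)
  (x y x' y' : R) : H x y = 1 -> H x' y' = 1 -> ~ (x = x' /\ y = y') ->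
  exists d, sector H S x y x' y' d.
Proof.
move=> /(curve_on_ray h) [t /andP[t1 t2] on] /(curve_on_ray h) [t' /andP[t1' t2'] on'] neq.
have [lt|lt|tE] := ltgtP t t'.
- exists (S t' - S t), t, t'; split => //; lra.
- exists (S (t' + pi *+ 2) - S t), t, (t' + pi *+ 2); split => //; [|lra|lra].
  by move: on'; rewrite /on_ray /radial cosD2pi sinD2pi.
- by exfalso; apply: neq; move: on on'; rewrite tE => -[-> ->] [-> ->].
Qed.

Lemma sector_areaE (R : realType) (e L D : R) H (h : strong_convex e L D H) (S : R -> R)
  (dS : forall t : R, is_derive t 1 S (radial H t ^+ 2)) (x y x' y' d : R) :
  sector H S x y x' y' d -> sector_area H S x y x' y' = d.
Proof.
move=> s; apply: (sector_unique h dS _ s).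
exact: (@xgetPex _ 0 (sector H S x y x' y')) (ex_intro _ d s).
Qed.

Lemma sector_area_local (R : realType) (e L D : R) H (h : strong_convex e L D H) (S : R -> R)
  (dS : forall t : R, is_derive t 1 S (radial H t ^+ 2)) (x0 y0 x0' y0' : R) :
  H x0 y0 = 1 -> H x0' y0' = 1 -> ~ (x0 = x0' /\ y0 = y0') ->
  forall k, 0 < k -> exists2 d, 0 < d & forall x y x' y', H x y = 1 -> H x' y' = 1 ->
    `|x - x0| + `|y - y0| < d -> `|x' - x0'| + `|y' - y0'| < d ->
    `|sector_area H S x y x' y' - sector_area H S x0 y0 x0' y0' -
       ((x0' * y' - y0' * x') - (x0 * y - y0 * x))| <=
    k * (`|x - x0| + `|y - y0| + (`|x' - x0'| + `|y' - y0'|)).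
Proof.
move=> h0 h0' neq k k0; have [a0 sec] := sector_exists h S h0 h0' neq.
have [t [t' [on on' lt lt' aE]]] := sec.
have [C C0 loc] := ray_local h dS on; have [C' C0' loc'] := ray_local h dS on'.
have [d1 d10 hd1] := loc k k0; have [d2 d20 hd2] := loc' k k0.
(* Small enough for the moved angles to satisfy [s < s' < s + 2 * pi] still. *)
pose w := Num.min (t' - t) (t + pi *+ 2 - t') / (2 * (1 + C + C')).
have CC : 0 < 2 * (1 + C + C') by lra.
have w0 : 0 < w by rewrite divr_gt0 // lt_min; apply/andP; split; lra.
exists (Num.min w (Num.min d1 d2)); first by rewrite !lt_min w0 d10.
move=> x y x' y' hxy hxy'; rewrite !lt_min => /and3P[b1 b2 _] /and3P[c1 _ c2].
have [s [os s1 s2]] := hd1 x y hxy b2; have [s' [os' s1' s2']] := hd2 x' y' hxy' c2.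
move: (`|x - x0| + _) (`|x' - x0'| + _) b1 c1 s1 s2 s1' s2' => E E' b1 c1 s1 s2 s1' s2'.
have wE : w * (2 * (1 + C + C')) = Num.min (t' - t) (t + pi *+ 2 - t') by rewrite divfK // gt_eqF.
have m1 : w * (2 * (1 + C + C')) <= t' - t by rewrite wE ge_min lexx.
have m2 : w * (2 * (1 + C + C')) <= t + pi *+ 2 - t' by rewrite wE ge_min lexx orbT.
have r1 : `|s - t| <= C * w by apply: (le_trans s1); rewrite ler_wpM2l // ltW.
have r2 : `|s' - t'| <= C' * w by apply: (le_trans s1'); rewrite ler_wpM2l // ltW.
have Cw : 0 <= C * w by rewrite mulr_ge0 // ltW.
have Cw' : 0 <= C' * w by rewrite mulr_ge0 // ltW.
have sec' : sector H S x y x' y' (S s' - S s).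
  exists s, s'; split => //; move: r1 r2 m1 m2 w0 Cw Cw'; rewrite !ler_norml; clear;
  move=> /andP[? ?] /andP[? ?] *; lra.
rewrite (sector_areaE h dS sec) (sector_areaE h dS sec') aE.
move: s2 s2'; rewrite !ler_norml; clear => /andP[? ?] /andP[? ?]; apply/andP; split; lra.
Qed.

(** * The variational argument *)

(** The frame of angle 0 with [al = pi / 2] is the standard one. *)
Lemma strong_convex_perturb (R : realType) (m M e : R) g : gauge m M g -> 0 < e ->
  exists e' L D, strong_convex e' L D (perturb e g).
Proof.
move=> G e0; have s0 : sin (pi / 2) != 0 :> R by rewrite sin_pihalf oner_neq0.
have := strong_convex_frame 0 G e0 s0.
have -> : frame (pi / 2) 0 (perturb e g) = perturb e g.
  apply/funext => x; apply/funext => y.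
  by rewrite /frame add0r cos0 sin0 cos_pihalf sin_pihalf !mulr1 !mulr0 addr0 add0r.
by move=> H; do 3 eexists; exact: H.
Qed.

Lemma directions_independent (R : realType) (al t a b : R) : sin al != 0 -> b != 0 ->
  ~ (a * cos t = b * cos (t + al) /\ a * sin t = b * sin (t + al)).
Proof.
move=> s0 b0 [E1 E2].
have [_] := @frame_inv R al t a (- b) 0 0 (ltac:(rewrite E1; lra)) (ltac:(rewrite E2; lra)).
by rewrite !mul0r subrr => /eqP; rewrite mulf_eq0 oppr_eq0 (negbTE b0) (negbTE s0).
Qed.

Lemma inscribed_pi (R : realType) (al : R) h (t c1 c2 a b : R) :
  inscribed al h (t + pi) c1 c2 a b -> inscribed al h t c1 c2 a b.
Proof.
rewrite /inscribed (addrAC t pi) !cosDpi !sinDpi !mulrN !opprK.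
by case=> a0 b0 [? ?] [? ?]; split.
Qed.

Lemma vertex_lip (R : realType) (C c c' s s' w w' d : R) : 0 <= s -> `|w'| <= 1 ->
  `|c' - c| <= C * d -> `|s' - s| <= C * d -> `|w' - w| <= d ->
  `|c' + s' * w' - (c + s * w)| <= (2 * C + s) * d.
Proof.
move=> s0 w1 hc hs hw.
have -> : c' + s' * w' - (c + s * w) = (c' - c) + (s' - s) * w' + s * (w' - w) by ring.
apply: (le_trans (ler_normD _ _)).
have -> : (2 * C + s) * d = C * d + C * d + s * d by ring.
apply: lerD; last by rewrite normrM (ger0_norm s0) ler_wpM2l.
apply: (le_trans (ler_normD _ _)); apply: lerD => //.
exact: le_trans (norm_mul_le _ w1) hs.
Qed.

Lemma vertex_lipN (R : realType) (C c c' s s' w w' d : R) : 0 <= s -> `|w'| <= 1 ->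
  `|c' - c| <= C * d -> `|s' - s| <= C * d -> `|w' - w| <= d ->
  `|c' - s' * w' - (c - s * w)| <= (2 * C + s) * d.
Proof.
move=> s0 w1 hc hs hw; rewrite -!mulrN; apply: vertex_lip => //; first by rewrite normrN.
by rewrite -opprD normrN.
Qed.

(* No center on the right: this is where bisection of the chords enters. *)
Lemma cross_sum (R : realType) (c1 c2 c1' c2' a b a' b' t t' al : R) :
  ((c1 + b * cos (t + al)) * (c2' + b' * sin (t' + al)) - (c2 + b * sin (t + al)) * (c1' + b' *
    cos (t' + al))
   - ((c1 + a * cos t) * (c2' + a' * sin t') - (c2 + a * sin t) * (c1' + a' * cos t'))) +
  ((c1 - b * cos (t + al)) * (c2' - b' * sin (t' + al)) - (c2 - b * sin (t + al)) * (c1' - b' *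
    cos (t' + al))
   - ((c1 - a * cos t) * (c2' - a' * sin t') - (c2 - a * sin t) * (c1' - a' * cos t'))) =
  2 * (b * b' - a * a') * sin (t' - t).
Proof.
have E1 : sin (t' - t) = sin t' * cos t - cos t' * sin t by rewrite sinB.
have E2 : sin (t' - t) = sin (t' + al) * cos (t + al) - cos (t' + al) * sin (t + al).
  by rewrite -sinB; congr sin; ring.
have -> : 2 * (b * b' - a * a') * sin (t' - t) = 2 * b * b' * sin (t' - t) - 2 * a * a' * sin
  (t' - t) by ring.
by rewrite {1}E2 E1; ring.
Qed.

Lemma inscribed_equal (R : realType) (m M e al : R) g : gauge m M g -> 0 < e ->
  sin al != 0 -> exists t c1 c2 a, 0 <= t <= pi /\ inscribed al (perturb e g) t c1 c2 a a.
Proof.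
move=> G e0 s0; set h := perturb e g.
have [e' [L [D sc]]] := strong_convex_perturb G e0.
have ex t : exists x : R * R * R * R, inscribed al h t x.1.1.1 x.1.1.2 x.1.2 x.2.
  by have [c1 [c2 [a [b ins]]]] := inscribed_exists t G e0 s0; exists (c1, c2, a, b).
have [f fP] := choice ex.
pose c1 t := (f t).1.1.1; pose c2 t := (f t).1.1.2; pose a t := (f t).1.2; pose b t := (f t).2.
have ins t : inscribed al h t (c1 t) (c2 t) (a t) (b t) := fP t.
(* This makes the functions just chosen Lipschitz, although [choice] promises no continuity. *)
have [C C0 lip] := inscribed_lipschitz G e0 s0.
have rc : continuous (fun t => radial h t ^+ 2).
  by move=> t; apply: cvgM; exact: (radial_continuous sc).
have [S dS] := antiderivative rc.
pose Phi t := sector_area h S (c1 t + a t * cos t) (c2 t + a t * sin t)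
    (c1 t + b t * cos (t + al)) (c2 t + b t * sin (t + al)) +
  sector_area h S (c1 t - a t * cos t) (c2 t - a t * sin t)
    (c1 t - b t * cos (t + al)) (c2 t - b t * sin (t + al)).
have dPhi (t : R) : is_derive t 1 Phi (2 * (b t ^+ 2 - a t ^+ 2)).
  have [a0 b0 [hP hL] [hT hB]] := ins t.
  have neqPT : ~ (c1 t + a t * cos t = c1 t + b t * cos (t + al) /\
                  c2 t + a t * sin t = c2 t + b t * sin (t + al)).
    move=> [/addrI ? /addrI ?]; apply: (@directions_independent R al t (a t) (b t)) => //.
    by rewrite gt_eqF.
  have neqLB : ~ (c1 t - a t * cos t = c1 t - b t * cos (t + al) /\
                  c2 t - a t * sin t = c2 t - b t * sin (t + al)).
    move=> [/addrI /oppr_inj ? /addrI /oppr_inj ?].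
    by apply: (@directions_independent R al t (a t) (b t)) => //; rewrite gt_eqF.
  apply/is_derive_epsP => k k0.
  (* Four errors of at most [k / 4 * |y - t|] are allowed: one for each sector, one for replacing
     [a y], [b y] by [a t], [b t] in [cross_sum], and one for replacing [sin (y - t)] by [y - t].
     [K] bounds the speed of the vertices in the sum norm, and [W] serves the third error. *)
  pose K := 2 * (2 * C + a t + b t) + 1.
  have K0 : 0 < K by rewrite /K; clear -C0 a0 b0; lra.
  have q0 : 0 < k / (8 * K) by rewrite divr_gt0 // mulr_gt0.
  have [d1 d10 loc1] := sector_area_local sc dS hP hT neqPT q0.
  have [d2 d20 loc2] := sector_area_local sc dS hL hB neqLB q0.
  pose Q := `|b t ^+ 2 - a t ^+ 2|.
  have Q0 : 0 <= Q := normr_ge0 _.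
  have r0 : 0 < k / (8 * (Q + 1)) by rewrite divr_gt0 // mulr_gt0 // ltr_wpDl.
  have /is_derive_epsP /(_ _ r0) [d3 d30 hd3] := is_derive_sin (0 : R).
  pose W := C * (a t + b t) + 1.
  have W0 : 0 < W.
    rewrite /W; have : 0 <= C * (a t + b t) by rewrite mulr_ge0 // addr_ge0 // ltW.
    by clear; lra.
  exists (Num.min (d1 / K) (Num.min (d2 / K) (Num.min d3 (k / (8 * W))))).
    by rewrite !lt_min d30 !divr_gt0 // mulr_gt0.
  move=> y; rewrite !lt_min => /and4P[y1 y2 y3 y4].
  rewrite ltr_pdivlMr // in y1; rewrite ltr_pdivlMr // in y2.
  have [l1 l2 l3 l4] := lip _ _ _ _ _ _ _ _ _ _ (ins t) (ins y).
  have [lc ls] := cos_sin_lip y t.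
  have [lc' ls'] := cos_sin_lip (y + al) (t + al).
  rewrite (_ : y + al - (t + al) = y - t) in lc' ls'; last by ring.
  have [_ _ [gP gL] [gT gB]] := ins y.
  set dl := `|y - t| in y1 y2 y3 y4 l1 l2 l3 l4 lc ls lc' ls' *.
  have dl0 : 0 <= dl := normr_ge0 _.
  have Kd x : 0 <= x -> 2 * x <= 2 * (a t + b t) -> (2 * C + x) * dl + (2 * C + x) * dl <= K * dl.
    move=> x0 xab; rewrite -mulrDl ler_wpM2r // /K; clear -xab; lra.
  have eP := le_trans (lerD (vertex_lip (ltW a0) (cos_max y) l1 l3 lc) (vertex_lip (ltW a0)
    (sin_max y) l2 l3 ls)) (Kd (a t) (ltW a0) (ltac:(clear -b0; lra))).
  have eT := le_trans (lerD (vertex_lip (ltW b0) (cos_max (y + al)) l1 l4 lc') (vertex_lip (ltW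
    b0) (sin_max (y + al)) l2 l4 ls')) (Kd (b t) (ltW b0) (ltac:(clear -a0; lra))).
  have eL := le_trans (lerD (vertex_lipN (ltW a0) (cos_max y) l1 l3 lc) (vertex_lipN (ltW a0)
    (sin_max y) l2 l3 ls)) (Kd (a t) (ltW a0) (ltac:(clear -b0; lra))).
  have eB := le_trans (lerD (vertex_lipN (ltW b0) (cos_max (y + al)) l1 l4 lc') (vertex_lipN
    (ltW b0) (sin_max (y + al)) l2 l4 ls')) (Kd (b t) (ltW b0) (ltac:(clear -a0; lra))).
  rewrite mulrC in y1; rewrite mulrC in y2.
  have N1 := loc1 _ _ _ _ gP gT (le_lt_trans eP y1) (le_lt_trans eT y1).
  have N2 := loc2 _ _ _ _ gL gB (le_lt_trans eL y2) (le_lt_trans eB y2).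
  have qK : k / (8 * K) * (K * dl + K * dl) = k / 4 * dl by field; rewrite gt_eqF.
  have M1 := le_trans N1 (ler_wpM2l (ltW q0) (lerD eP eT)).
  have M2 := le_trans N2 (ler_wpM2l (ltW q0) (lerD eL eB)).
  rewrite qK in M1 M2; clear N1 N2 eP eT eL eB.
  have X := cross_sum (c1 t) (c2 t) (c1 y) (c2 y) (a t) (b t) (a y) (b y) t y al.
  rewrite /Phi; move: X M1 M2.
  move: (sector_area _ _ (c1 y + _) _ _ _) (sector_area _ _ (c1 t + _) _ _ _).
  move: (sector_area _ _ (c1 y - _) _ _ _) (sector_area _ _ (c1 t - _) _ _ _).
  set X1 := (_ * _ - _ * _ - (_ * _ - _ * _)); set X2 := (_ * _ - _ * _ - (_ * _ - _ * _)).
  move: X1 X2 => X1 X2 A2 A20 A1 A10 X M1 M2.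
  have F2 : `|sin (y - t) - (y - t)| <= k / (8 * (Q + 1)) * dl.
    by have := hd3 (y - t); rewrite sin0 cos0 !subr0 mul1r; apply.
  have F4 : `|sin (y - t)| <= dl.
    by have [_] := cos_sin_lip (y - t) 0; rewrite sin0 !subr0.
  have P1 : `|2 * (b t ^+ 2 - a t ^+ 2) * (sin (y - t) - (y - t))| <= k / 4 * dl.
    rewrite 2!normrM ger0_norm // -/Q.
    apply: (@le_trans _ _ (2 * (Q + 1) * (k / (8 * (Q + 1)) * dl))).
      apply: ler_pM => //; [by rewrite mulr_ge0 | by rewrite ler_pM2l // lerDl].
    have -> : 2 * (Q + 1) * (k / (8 * (Q + 1)) * dl) = k / 4 * dl.
      by field; rewrite gt_eqF // ltr_wpDl.
    exact: lexx.
  have P2 : `|2 * (b t * (b y - b t) - a t * (a y - a t)) * sin (y - t)| <= k / 4 * dl.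
    rewrite 2!normrM (ger0_norm (_ : 0 <= 2)) //.
    have B1 : `|b t * (b y - b t) - a t * (a y - a t)| <= W * dl.
      apply: (le_trans (ler_normB _ _)); rewrite !normrM (gtr0_norm a0) (gtr0_norm b0).
      have := ler_wpM2l (ltW a0) l3; have := ler_wpM2l (ltW b0) l4.
      by rewrite /W; move: dl0; clear; lra.
    have B2 : W * dl <= k / 8.
      move: y4; rewrite invfM mulrA ltr_pdivlMr // => /ltW; rewrite mulrC => /le_trans; apply.
      by rewrite lexx.
    have := ler_pM (normr_ge0 _) (normr_ge0 _) (le_trans B1 B2) F4.
    by clear; lra.
  have -> : A1 + A2 - (A10 + A20) - 2 * (b t ^+ 2 - a t ^+ 2) * (y - t) =
     (A1 - A10 - X1) + (A2 - A20 - X2) + (2 * (b t * (b y - b t) - a t * (a y - a t)) * sin (y -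
       t) +
     2 * (b t ^+ 2 - a t ^+ 2) * (sin (y - t) - (y - t))).
    have -> : X1 = 2 * (b t * b y - a t * a y) * sin (y - t) - X2 by rewrite -X addrK.
    by ring.
  apply: (le_trans (ler_normD _ _)).
  apply: (le_trans (lerD (le_trans (ler_normD _ _) (lerD M1 M2)) (le_trans (ler_normD _ _) (lerD
    P2 P1)))).
  by clear; lra.
(* The parallelogram chosen at [pi] is also inscribed at 0, so [lip] with equal angles identifies it
   with the one chosen there; the two sectors are exchanged. *)
have Phi_pi : Phi 0 = Phi pi.
  have := ins pi; rewrite -[pi in inscribed _ _ pi _ _ _ _]add0r => /inscribed_pi ins0.
  have [] := lip _ _ _ _ _ _ _ _ _ _ (ins 0) ins0.
  rewrite subrr normr0 mulr0 !normr_le0 !subr_eq0 => /eqP E1 /eqP E2 /eqP E3 /eqP E4.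
  rewrite /Phi E1 E2 E3 E4 (addrC pi) cosDpi sinDpi cospi sinpi cos0 sin0 add0r.
  by rewrite !mulrN !mulr0 !opprK !oppr0 ?subr0 addrC.
have dv x : x \in `]0, pi[ -> derivable Phi x 1 by move=> _; have [] := dPhi x.
have [|t t0 dt] := Rolle (pi_gt0 R) dv _ Phi_pi.
  by apply: derivable_within_continuous => x _; have [] := dPhi x.
have : 2 * (b t ^+ 2 - a t ^+ 2) = 0.
  by rewrite -(derive_val (is_derive := dPhi t)) (derive_val (is_derive := dt)).
move=> ab; have [a0 b0 _ _] := ins t.
have abE : a t = b t.
  apply/eqP; rewrite -(@eqrXn2 _ 2) //; try exact: ltW.
  by apply/eqP; lra.
exists t, (c1 t), (c2 t), (a t); split; last by have := ins t; rewrite -abE.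
by move: t0; rewrite in_itv /= => /andP[/ltW -> /ltW ->].
Qed.

(** * Removing the strong convexity *)

(** Continuity is inherited from [perturb 1 g] by subtracting the quadratic term. *)
Lemma gauge_cvg (R : realType) (m M : R) g (G : gauge m M g) (T : Type) (F : set_system T)
  {FF : Filter F} (x y : T -> R) (x0 y0 : R) :
  x s @[s --> F] --> x0 -> y s @[s --> F] --> y0 -> g (x s) (y s) @[s --> F] --> g x0 y0.
Proof.
move=> cx cy; have [e' [L [D sc]]] := strong_convex_perturb G ltr01.
have gE : g = fun x y => perturb 1 g x y - (x * x + y * y).
  by apply/funext => u; apply/funext => v; rewrite /perturb; ring.
rewrite [in X in X --> _]gE [in X in _ --> X]gE; apply: cvgB; first exact: (strong_convex_cvg sc).
by apply: cvgD; apply: cvgM.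
Qed.

Lemma vertex_defect_cvg (R : realType) (m M : R) g (G : gauge m M g) (T : Type) (F : set_system T)
  {FF : Filter F} (c1 c2 a t : T -> R) (c1' c2' a' t' s w : R) :
  c1 x @[x --> F] --> c1' -> c2 x @[x --> F] --> c2' ->
  a x @[x --> F] --> a' -> t x @[x --> F] --> t' ->
  `|g (c1 x + s * a x * cos (t x + w)) (c2 x + s * a x * sin (t x + w)) - 1| @[x --> F] -->
  `|g (c1' + s * a' * cos (t' + w)) (c2' + s * a' * sin (t' + w)) - 1|.
Proof.
move=> h1 h2 ha ht.
have tw : t x + w @[x --> F] --> t' + w by apply: cvgD => //; exact: cvg_cst.
have sa : s * a x @[x --> F] --> s * a' by apply: cvgM => //; exact: cvg_cst.
apply: cvg_norm; apply: cvgB; last exact: cvg_cst.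
apply: (gauge_cvg G); apply: cvgD => //; apply: cvgM => //; apply: cvg_comp tw _.
  exact: continuous_cos.
exact: continuous_sin.
Qed.

Lemma perturb_defect (R : realType) (m M e x y : R) g : gauge m M g -> 0 < e ->
  perturb e g x y = 1 -> `|g x y - 1| <= e * m^-1 ^+ 2.
Proof.
move=> G e0 h.
have le := perturb_bound G (ltW e0) (ltac:(by rewrite h) : perturb e g x y <= 1).
have -> : g x y - 1 = - (e * (x ^+ 2 + y ^+ 2)) by move: h; rewrite /perturb; lra.
rewrite normrN ger0_norm; last by rewrite mulr_ge0 ?(ltW e0) // addr_ge0 ?sqr_ge0.
rewrite ler_pM2l //; apply: (@le_trans _ _ ((`|x| + `|y|) ^+ 2)).
  rewrite sqrrD !real_normK ?num_real //.
  have : 0 <= `|x| * `|y| by rewrite mulr_ge0.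
  by rewrite mulr2n; clear; lra.
by rewrite lerXn2r ?nnegrE ?addr_ge0 // (le_trans _ le) // addr_ge0.
Qed.

(** The limit is taken without sequences: the sum of the four defects [|g - 1|] attains its minimum
    on a compact box of data, and the rectangles found for [perturb e g] show that this minimum is
    at most a multiple of [e]. *)
Lemma inscribed_gauge (R : realType) (m M al : R) g : gauge m M g ->
  sin al != 0 -> exists t c1 c2 a, inscribed al g t c1 c2 a a.
Proof.
move=> G s0; have M0 := gauge_upper_ge0 G; have m0 := gauge_gt0 G.
(* [r] is the lower bound of [inscribed_big] made uniform in [e <= 1]; it keeps the minimizer
   nondegenerate. *)
pose r := (4 * M + 6)^-1 / 2; pose D := m^-1 / `|sin al|.
have r0 : 0 < r by rewrite divr_gt0 // invr_gt0; lra.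
(* The entries are the center [c1], [c2], the half-diagonal [a] and the angle [t]. In [X] and [Y],
   [s = 1] or [-1] and [w = 0] or [al] select the vertex. *)
pose lo : 'rV[R]_4 := \row_i [tuple - m^-1; - m^-1; r; 0]`_i.
pose hi : 'rV[R]_4 := \row_i [tuple m^-1; m^-1; D; pi]`_i.
pose A := [set v : 'rV[R]_4 | forall i, `[lo ord0 i, hi ord0 i]%classic (v ord0 i)].
pose X (s w : R) (v : 'rV[R]_4) := v ord0 0 + s * v ord0 2 * cos (v ord0 3 + w).
pose Y (s w : R) (v : 'rV[R]_4) := v ord0 1 + s * v ord0 2 * sin (v ord0 3 + w).
pose f0 (s w : R) v := `|g (X s w v) (Y s w v) - 1|.
pose f v := f0 1 0 v + f0 (-1) 0 v + f0 1 al v + f0 (-1) al v.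
have cA : compact A by exact: (@rV_compact R 4 (fun i => `[lo ord0 i, hi ord0 i]%classic) (fun i
  => @segment_compact R _ _)).
have fE v : f v = f0 1 0 v + f0 (-1) 0 v + f0 1 al v + f0 (-1) al v by [].
have f0c s w : continuous (f0 s w).
  move=> v; have cc i : (fun u : 'rV[R]_4 => u ord0 i) @ v --> v ord0 i by exact:
    coord_continuous.
  exact: (@vertex_defect_cvg _ _ _ _ G _ _ (nbhs_filter v) _ _ _ _ _ _ _ _ s w (cc 0) (cc 1) (cc
    2) (cc 3)).
have fc : continuous f.
  move=> v; have FF := nbhs_filter v.
  by apply: cvgD (f0c _ _ _); apply: cvgD (f0c _ _ _); exact: cvgD (f0c _ _ _) (f0c _ _ _).
have approx e : 0 < e -> e <= 1 -> exists2 v, A v & f v <= e * (4 * m^-1 ^+ 2).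
  move=> e0 e1; have [t [c1 [c2 [a [/andP[t0 tpi] ins]]]]] := inscribed_equal G e0 s0.
  have [cb aD _] := inscribed_le G e0 s0 ins.
  have [ra _] := inscribed_big G e0 s0 ins.
  have [_ _ [hP hL] [hT hB]] := ins.
  have bd (x z : R) : 0 <= z -> `|x| + z <= m^-1 -> - m^-1 <= x <= m^-1.
    by move=> z0 xz; rewrite -ler_norml; apply: le_trans xz; rewrite lerDl.
  have ra' : r <= a.
    have : (4 * M + 6)^-1 <= (4 * M + 4 * e + 2)^-1 by rewrite lef_pV2 ?posrE //; lra.
    by move: ra; rewrite /r; clear; lra.
  exists (\row_i [tuple c1; c2; a; t]`_i).
    move=> i; rewrite /= in_itv /= !mxE; case: i => [[|[|[|[|//]]]] ?] /=.
    - exact: (bd _ `|c2|).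
    - by apply: (bd _ `|c1|) => //; rewrite addrC.
    - by rewrite ra'.
    - by rewrite t0.
  rewrite /f /f0 /X /Y !mxE /= !mul1r !mulN1r !mulNr addr0.
  have := perturb_defect G e0 hP; have := perturb_defect G e0 hL.
  have := perturb_defect G e0 hT; have := perturb_defect G e0 hB.
  by clear; lra.
have A0 : A !=set0 by have [v Av _] := approx 1 ltr01 (lexx _); exists v.
have [|v Av vmin] := EVT_min_rV A0 cA (f := f); first exact: continuous_subspaceT.
have f0_ge0 s w : 0 <= f0 s w v by exact: normr_ge0.
have fv0 : f v = 0.
  apply/eqP; rewrite eq_le; apply/andP; split; last by rewrite /f !addr_ge0.
  rewrite leNgt; apply/negP => fpos.
  have q0 : 0 < 4 * m^-1 ^+ 2 by rewrite mulr_gt0 // exprn_gt0 // invr_gt0.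
  (* With this [e] some point of [A] has value at most [f v / 2]. *)
  pose e := Num.min 1 (f v / (2 * (4 * m^-1 ^+ 2))).
  have e0 : 0 < e by rewrite lt_min ltr01 divr_gt0 // mulr_gt0.
  have e1 : e <= 1 by rewrite ge_min lexx.
  have e2 : e * (2 * (4 * m^-1 ^+ 2)) <= f v.
    by rewrite -ler_pdivlMr; [rewrite /e ge_min lexx orbT | exact: mulr_gt0].
  have [w Aw fw] := approx e e0 e1.
  have := vmin w; rewrite inE => /(_ Aw).
  by move: fw e2 fpos; clear; lra.
have g1 s w : f0 s w v = 0 -> g (X s w v) (Y s w v) = 1.
  by move=> /eqP; rewrite normr_eq0 subr_eq0 => /eqP.
have h1 := f0_ge0 1 0; have h2 := f0_ge0 (-1) 0; have h3 := f0_ge0 1 al; have h4 := f0_ge0 (-1)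
  al.
have a0 : 0 < v ord0 2.
  have vA : A v by rewrite inE in Av.
  by have := vA 2; rewrite /= in_itv /= !mxE /= => /andP[/(lt_le_trans r0)].
exists (v ord0 3), (v ord0 0), (v ord0 1), (v ord0 2).
have E1 := g1 1 0 (ltac:(rewrite fE in fv0; lra)).
have E2 := g1 (-1) 0 (ltac:(rewrite fE in fv0; lra)).
have E3 := g1 1 al (ltac:(rewrite fE in fv0; lra)).
have E4 := g1 (-1) al (ltac:(rewrite fE in fv0; lra)).
move: E1 E2 E3 E4; rewrite /X /Y !mul1r !mulN1r !mulNr addr0 => E1 E2 E3 E4.
by split.
Qed.

(** * Minkowski gauges *)

Definition gauge_of (R : realType) (C : R -> R -> Prop) (x y : R) : R :=
  inf [set t | 0 < t /\ C (x / t) (y / t)].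

Lemma gauge_ofP (R : realType) (C : R -> R -> Prop) (r B : R) : 0 < r -> 0 < B ->
  (forall t x y x' y', 0 <= t -> t <= 1 -> C x y -> C x' y' ->
     C ((1 - t) * x + t * x') ((1 - t) * y + t * y')) ->
  (forall x y, `|x| < r -> `|y| < r -> C x y) ->
  (forall x y, C x y -> `|x| <= B /\ `|y| <= B) ->
  gauge (2 * B)^-1 r^-1 (gauge_of C).
Proof.
move=> r0 B0 conv inner outer.
pose E (x y : R) := [set t | 0 < t /\ C (x / t) (y / t)].
have inE x y t : 0 < t -> (`|x| + `|y|) / r < t -> E x y t.
  move=> t0 lt; split => //.
  by apply: inner; rewrite normrM normfV (gtr0_norm t0) ltr_pdivrMr // mulrC;
    move: lt; rewrite ltr_pdivrMr //; apply: le_lt_trans; rewrite ?lerDl ?lerDr.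
have lower x y t : E x y t -> (2 * B)^-1 * (`|x| + `|y|) <= t.
  move=> [t0 /outer []]; rewrite !normrM normfV (gtr0_norm t0) !ler_pdivrMr // => h1 h2.
  by rewrite mulrC ler_pdivrMr ?mulr_gt0 //; lra.
have hasinf x y : has_inf (E x y).
  split; last by exists ((2 * B)^-1 * (`|x| + `|y|)) => t /lower.
  exists ((`|x| + `|y|) / r + 1); apply: inE; last by rewrite ltrDl.
  by rewrite ltr_wpDl // divr_ge0 ?addr_ge0 // ltW.
have infle x y t : E x y t -> gauge_of C x y <= t.
  by move=> ?; apply: ge_inf => //; case: (hasinf x y).
have adh x y k : 0 < k -> exists2 t, E x y t & t < gauge_of C x y + k.
  by move=> k0; exact: inf_adherent.
have low x y : (2 * B)^-1 * (`|x| + `|y|) <= gauge_of C x y.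
  by apply: lb_le_inf; [case: (hasinf x y) | move=> t; exact: lower].
have up x y : gauge_of C x y <= r^-1 * (`|x| + `|y|).
  rewrite leNgt; apply/negP => lt.
  pose t := (gauge_of C x y + r^-1 * (`|x| + `|y|)) / 2.
  have t1 : r^-1 * (`|x| + `|y|) < t by rewrite /t; lra.
  have t2 : t < gauge_of C x y by rewrite /t; lra.
  have : gauge_of C x y <= t.
    apply: infle; apply: inE; last by rewrite mulrC.
    by apply: le_lt_trans t1; rewrite mulr_ge0 ?addr_ge0 // invr_ge0 ltW.
  by rewrite leNgt t2.
(* The reverse inequality will be this one for [k^-1]. *)
have homo_le k x y : 0 < k -> gauge_of C (k * x) (k * y) <= k * gauge_of C x y.
  move=> k0; rewrite leNgt; apply/negP => lt.
  pose d := (gauge_of C (k * x) (k * y) - k * gauge_of C x y) / k.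
  have d0 : 0 < d by rewrite divr_gt0 // subr_gt0.
  have [t [t0 Ct] tlt] := adh x y d d0.
  have : gauge_of C (k * x) (k * y) <= k * t.
    apply: infle; split; first exact: mulr_gt0.
    have kN : k != 0 by rewrite gt_eqF.
    have tN : t != 0 by rewrite gt_eqF.
    have -> : k * x / (k * t) = x / t by field; rewrite kN tN.
    by have -> : k * y / (k * t) = y / t by field; rewrite kN tN.
  rewrite leNgt => /negP; apply.
  have : k * t < k * (gauge_of C x y + d) by rewrite ltr_pM2l.
  by rewrite /d mulrDr mulrCA divff ?gt_eqF // mulr1 subrKC.
split => //.
- by rewrite invr_gt0 mulr_gt0.
- move=> k x y; rewrite le_eqVlt => /orP[/eqP <-|k0].
    rewrite !mul0r; apply/eqP; rewrite eq_le.
    by have := low 0 0; have := up 0 0; rewrite normr0 addr0 !mulr0 => -> ->.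
  apply/eqP; rewrite eq_le homo_le //= -ler_pdivlMl //.
  have kN : k != 0 by rewrite gt_eqF.
  have := homo_le k^-1 (k * x) (k * y); rewrite invr_gt0 => /(_ k0).
  by rewrite !mulKf.
- move=> x y x' y'; rewrite leNgt; apply/negP => lt.
  pose d := (gauge_of C (x + x') (y + y') - (gauge_of C x y + gauge_of C x' y')) / 2.
  have d0 : 0 < d by rewrite divr_gt0 // subr_gt0.
  have [t [t0 Ct] tlt] := adh x y d d0; have [s [s0 Cs] slt] := adh x' y' d d0.
  have ts0 : 0 < t + s by rewrite addr_gt0.
  have tN : t != 0 by rewrite gt_eqF.
  have sN : s != 0 by rewrite gt_eqF.
  have tsN : t + s != 0 by rewrite gt_eqF.
  have : gauge_of C (x + x') (y + y') <= t + s.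
    apply: infle; split => //.
    have := conv (s / (t + s)) _ _ _ _ _ _ Ct Cs.
    have -> : (1 - s / (t + s)) * (x / t) + s / (t + s) * (x' / s) = (x + x') / (t + s).
      by field; rewrite tN sN tsN.
    have -> : (1 - s / (t + s)) * (y / t) + s / (t + s) * (y' / s) = (y + y') / (t + s).
      by field; rewrite tN sN tsN.
    apply; first by rewrite divr_ge0 // ltW.
    by rewrite ler_pdivrMr // mul1r lerDr ltW.
  by move: tlt slt; rewrite /d; clear; lra.
Qed.

(** There are factors [t >= 1] arbitrarily close to 1 with [(x / t, y / t)] in [C], which puts the
    point in the closure. *)
Lemma gauge_of1_approx (R : realType) (C : R -> R -> Prop) (x y d : R) : 0 < d ->
  gauge_of C x y = 1 -> exists x' y', [/\ C x' y', `|x' - x| < d & `|y' - y| < d].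
Proof.
move=> d0 g1; pose E := [set t | 0 < t /\ C (x / t) (y / t)].
have infE : inf E = 1 by [].
(* A set without infimum has [inf] equal to 0 by default, which the value 1 excludes. *)
have Ei : has_inf E.
  apply: contrapT => /inf_out i0; move: infE; rewrite i0 => /eqP; by rewrite eq_sym oner_eq0.
pose k := d / (`|x| + `|y| + 1).
have n0 : 0 < `|x| + `|y| + 1 by rewrite ltr_wpDl // addr_ge0.
have k0 : 0 < k by rewrite divr_gt0.
have [t [t0 Ct] tlt] := inf_adherent k0 Ei.
have t1 : 1 <= t by rewrite -infE; apply: ge_inf => //; case: Ei.
have tk : t - 1 < k by rewrite infE in tlt; lra.
have small z : `|z| < `|x| + `|y| + 1 -> `|z / t - z| < d.
  move=> zn; have -> : z / t - z = - (z * ((t - 1) / t)) by field; rewrite gt_eqF.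
  have q0 : 0 <= (t - 1) / t by rewrite divr_ge0 ?subr_ge0 // ltW.
  rewrite normrN normrM (ger0_norm q0).
  have le1 : (t - 1) / t <= t - 1.
    by rewrite ler_pdivrMr // ler_peMr // subr_ge0.
  have -> : d = (`|x| + `|y| + 1) * k by rewrite mulrC divfK // gt_eqF.
  by apply: ltr_pM => //; exact: le_lt_trans tk.
exists (x / t), (y / t); split => //; apply: small.
  by have := normr_ge0 y; lra.
by have := normr_ge0 x; lra.
Qed.

(** If [C] contained a neighbourhood, it would contain the point enlarged by some [1 + k], and the
    gauge would be at most [1 / (1 + k)]. *)
Lemma gauge_of1_extreme (R : realType) (C : R -> R -> Prop) (x y d : R) : 0 < d ->
  (forall x' y', `|x' - x| < d -> `|y' - y| < d -> C x' y') -> gauge_of C x y <> 1.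
Proof.
move=> d0 Cd g1; pose E := [set t | 0 < t /\ C (x / t) (y / t)].
have infE : inf E = 1 by [].
have Ei : has_inf E.
  apply: contrapT => /inf_out i0; move: infE; rewrite i0 => /eqP; by rewrite eq_sym oner_eq0.
have n0 : 0 < `|x| + `|y| + 1 by rewrite ltr_wpDl // addr_ge0.
pose k := d / (`|x| + `|y| + 1).
have k0 : 0 < k by rewrite divr_gt0.
have small z : `|z| < `|x| + `|y| + 1 -> `|z / (1 + k)^-1 - z| < d.
  move=> zn; rewrite invrK mulrDr mulr1 addrAC subrr add0r normrM (gtr0_norm k0).
  have -> : d = (`|x| + `|y| + 1) * k by rewrite mulrC divfK // gt_eqF.
  by rewrite ltr_pM2r.
have : inf E <= (1 + k)^-1.
  apply: ge_inf; first by case: Ei.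
  split; first by rewrite invr_gt0 addr_gt0.
  by apply: Cd; apply: small; [have := normr_ge0 y | have := normr_ge0 x]; lra.
rewrite infE; apply/negP; rewrite -ltNge invf_lt1 ?addr_gt0 //; lra.
Qed.

Definition vec2 (R : realType) (x y : R) : plane R := \row_j (if j == 0 then x else y).

Lemma plane_eq (R : realType) (p q : plane R) : p 0 0 = q 0 0 -> p 0 1 = q 0 1 -> p = q.
Proof.
move=> h0 h1; apply/rowP => j; have [->//|j0] := eqVneq j 0.
by have -> : j = 1 by case: j j0 => [[|[|//]]] // ? _; apply/val_inj.
Qed.

Lemma ball_vec2 (R : realType) (o : plane R) (x y x' y' d : R) : 0 < d ->
  `|x' - x| < d -> `|y' - y| < d -> ball (o + vec2 x y) d (o + vec2 x' y').
Proof.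
move=> d0 hx hy; split => // i j; rewrite /ball /= !mxE.
case: ifP => _.
  have -> : o i j + x - (o i j + x') = - (x' - x) by ring.
  by rewrite normrN.
have -> : o i j + y - (o i j + y') = - (y' - y) by ring.
by rewrite normrN.
Qed.

Lemma closed_convex_curve_gauge (R : realType) (gamma : set (plane R)) :
  closed_convex_curve gamma -> exists o m M g, gauge m M g /\
    forall x y, g x y = 1 -> gamma (o + vec2 x y).
Proof.
move=> [K [cK convK [z zK] ->]]; exists z.
pose C x y := K (z + vec2 x y).
have [r /= r0 hr] : exists2 r : R, 0 < r & ball z r `<=` K by apply/nbhs_ballP.
have [B [Breal hB]] := compact_bounded cK.
pose B' := `|B| + 1 + `|z 0 0| + `|z 0 1|.
have z0 : z = z + vec2 0 0.
  by apply/rowP => j; rewrite !mxE if_same addr0.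
have coord (v : plane R) j : `|v 0 j| <= `|v|.
  by rewrite [leRHS]/Num.norm /= mx_normrE; apply/bigmax_geP; right => /=; exists (0, j).
have gC : gauge (2 * B')^-1 r^-1 (gauge_of C).
  apply: gauge_ofP => //.
  - by rewrite /B' ltr_wpDr // ltr_wpDr // ltr_wpDl.
  - move=> t x y x' y' t0 t1 h h'.
    have := convK _ _ (Itv01 t0 t1) (mem_set h') (mem_set h); rewrite inE /C.
    congr K; rewrite /conv /=; apply/rowP => j; rewrite !mxE /unstable.onem.
    by case: ifP => _; ring.
  - by move=> x y hx hy; apply: hr; rewrite {1}z0; apply: ball_vec2; rewrite ?subr0.
  - move=> x y; rewrite /C => h.
    have := hB (`|B| + 1) (ltac:(by rewrite (le_lt_trans (ler_norm _)) // ltrDl)) _ h.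
    rewrite /= => n1.
    have tri (u w : R) : `|u + w| <= `|B| + 1 -> `|w| <= `|B| + 1 + `|u|.
      move=> uw; have -> : w = u + w - u by ring.
      by rewrite (le_trans (ler_normB _ _)) // lerD2r.
    split.
      have := le_trans (coord _ 0) n1; rewrite !mxE /= => /tri /le_trans; apply.
      by rewrite /B' lerDl.
    have := le_trans (coord _ 1) n1; rewrite !mxE /= => /tri /le_trans; apply.
    by rewrite /B' lerD2r lerDl.
exists (2 * B')^-1, r^-1, (gauge_of C); split => // x y g1; split.
- move=> U /nbhs_ballP [d /= d0 hd].
  have [x' [y' [h hx hy]]] := gauge_of1_approx d0 g1.
  by exists (z + vec2 x' y'); split => //; apply: hd; exact: ball_vec2.
- move=> /nbhs_ballP [d /= d0 hd].
  apply: (gauge_of1_extreme d0 _ g1) => x' y' hx hy.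
  by apply: hd; exact: ball_vec2.
Qed.

(** * Rectangles *)

Lemma dotE (R : realType) (u v : plane R) : dot u v = u 0 0 * v 0 0 + u 0 1 * v 0 1.
Proof.
rewrite /dot mxE !big_ord_recl big_ord0 addr0 !mxE /=.
by have -> : lift ord0 ord0 = 1 :> 'I_2 by apply/val_inj.
Qed.

(** The sides [s0], ..., [s3] sum to 0, so the squared length of [s0 + s2] is minus its dot product
    with [s1 + s3], which expands into the four right angles. *)
Lemma rectangle_opposite_sides (R : realType) (Q : quadrilateral R) : rectangle Q ->
  Q 0 + Q 2 = Q 1 + Q 3.
Proof.
move=> rQ.
have [_] := rQ 0; have [_] := rQ 1; have [_] := rQ 2; have [_] := rQ 3.
rewrite !dotE /side.
have i3 : (3 : 'I_4) + 1 = 0 by apply/val_inj.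
have i2 : (2 : 'I_4) + 1 = 3 by apply/val_inj.
have i1 : (1 : 'I_4) + 1 = 2 by apply/val_inj.
have i0 : (0 : 'I_4) + 1 = 1 by apply/val_inj.
rewrite !(i0, i1, i2, i3).
rewrite !mxE => o3 o2 o1 o0.
suff [e0 e1] : Q 0 0 0 + Q 2 0 0 = Q 1 0 0 + Q 3 0 0 /\ Q 0 0 1 + Q 2 0 1 = Q 1 0 1 + Q 3 0 1.
  by apply: plane_eq; rewrite !mxE.
move: o3 o2 o1 o0.
move: (Q 0 0 0) (Q 0 0 1) (Q 1 0 0) (Q 1 0 1) (Q 2 0 0) (Q 2 0 1) (Q 3 0 0) (Q 3 0 1).
move=> a b c d e f g h o3 o2 o1 o0.
have : (a + e - (c + g)) ^+ 2 + (b + f - (d + h)) ^+ 2 = 0 by lra.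
move=> /eqP; rewrite paddr_eq0 ?sqr_ge0 // !sqrf_eq0 !subr_eq0 => /andP[/eqP -> /eqP ->].
by [].
Qed.

Lemma rectangle_diagonals (R : realType) (Q : quadrilateral R) : rectangle Q ->
  exists m r b al, [/\ 0 < r, sin al != 0,
    Q 0 = m + vec2 (r * cos b) (r * sin b), Q 2 = m - vec2 (r * cos b) (r * sin b) &
    Q 1 = m + vec2 (r * cos (b + al)) (r * sin (b + al)) /\
    Q 3 = m - vec2 (r * cos (b + al)) (r * sin (b + al))].
Proof.
move=> rQ; have op := rectangle_opposite_sides rQ.
have [s0 o0] := rQ 0; have [s1 _] := rQ 1.
move: s0 s1 o0; rewrite dotE /side.
have i1 : (1 : 'I_4) + 1 = 2 by apply/val_inj.
have i0 : (0 : 'I_4) + 1 = 1 by apply/val_inj.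
rewrite !(i0, i1) => s0 s1; rewrite !mxE => o0.
pose m := 2^-1 *: (Q 0 + Q 2).
pose u := (Q 0 0 0 - Q 2 0 0) / 2; pose v := (Q 0 0 1 - Q 2 0 1) / 2.
pose u' := (Q 1 0 0 - Q 3 0 0) / 2; pose v' := (Q 1 0 1 - Q 3 0 1) / 2.
have op0 : Q 0 0 0 + Q 2 0 0 = Q 1 0 0 + Q 3 0 0 by move: op => /rowP /(_ 0); rewrite !mxE.
have op1 : Q 0 0 1 + Q 2 0 1 = Q 1 0 1 + Q 3 0 1 by move: op => /rowP /(_ 1); rewrite !mxE.
have Q0E : Q 0 = m + vec2 u v by apply: plane_eq; rewrite !mxE /= /u /v; lra.
have Q2E : Q 2 = m - vec2 u v by apply: plane_eq; rewrite !mxE /= /u /v; lra.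
have Q1E : Q 1 = m + vec2 u' v' by apply: plane_eq; rewrite !mxE /= /u' /v'; lra.
have Q3E : Q 3 = m - vec2 u' v' by apply: plane_eq; rewrite !mxE /= /u' /v'; lra.
have nz (p q : plane R) : p - q != 0 -> 0 < (p 0 0 - q 0 0) ^+ 2 + (p 0 1 - q 0 1) ^+ 2.
  move=> pq; rewrite lt0r addr_ge0 ?sqr_ge0 // andbT paddr_eq0 ?sqr_ge0 // !sqrf_eq0.
  apply: contra pq => /andP[/eqP e0 /eqP e1].
  by apply/eqP/plane_eq; rewrite !mxE.
have n0 := nz _ _ s0; have n1 := nz _ _ s1.
(* Lagrange's identity: adjacent sides are orthogonal, so the product of their squared lengths is
   the square of their cross product, which is twice that of the half-diagonals. *)
have cross : u * v' - v * u' != 0.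
  apply/eqP => cr.
  have : 0 < ((Q 1 0 0 - Q 0 0 0) ^+ 2 + (Q 1 0 1 - Q 0 0 1) ^+ 2) *
             ((Q 2 0 0 - Q 1 0 0) ^+ 2 + (Q 2 0 1 - Q 1 0 1) ^+ 2) by rewrite mulr_gt0.
  have -> : forall x y z w : R, (x ^+ 2 + y ^+ 2) * (z ^+ 2 + w ^+ 2) =
     (x * z + y * w) ^+ 2 + (x * w - y * z) ^+ 2 by move=> *; ring.
  have -> : (Q 1 0 0 - Q 0 0 0) * (Q 2 0 1 - Q 1 0 1) - (Q 1 0 1 - Q 0 0 1) * (Q 2 0 0 - Q 1 0
    0) =
     2 * (u * v' - v * u').
    have -> : u' = (Q 1 0 0 - (Q 0 0 0 + Q 2 0 0 - Q 1 0 0)) / 2 by rewrite /u'; lra.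
    have -> : v' = (Q 1 0 1 - (Q 0 0 1 + Q 2 0 1 - Q 1 0 1)) / 2 by rewrite /v'; lra.
    by rewrite /u /v; lra.
  by rewrite cr o0 mulr0 expr0n /= addr0 ltxx.
(* Thales: the right angle at [Q 1] puts it on the circle whose diameter joins [Q 0] and [Q 2]. *)
have len : u ^+ 2 + v ^+ 2 = u' ^+ 2 + v' ^+ 2.
  have -> : u' = (Q 1 0 0 - (Q 0 0 0 + Q 2 0 0 - Q 1 0 0)) / 2 by rewrite /u'; lra.
  have -> : v' = (Q 1 0 1 - (Q 0 0 1 + Q 2 0 1 - Q 1 0 1)) / 2 by rewrite /v'; lra.
  by rewrite /u /v; lra.
have [|r [b [r0 _ _ uE vE]]] := @polar_exists R u v.
  by move=> [u0 v0]; move: cross; rewrite u0 v0 !mul0r subrr eqxx.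
have [|r' [b' [r0' _ _ uE' vE']]] := @polar_exists R u' v'.
  by move=> [u0 v0]; move: cross; rewrite u0 v0 !mulr0 subrr eqxx.
have rr : r' = r.
  apply/eqP; rewrite -(@eqrXn2 _ 2) ?ltW //; apply/eqP.
  have E (x y : R) : x ^+ 2 = (x * cos y) ^+ 2 + (x * sin y) ^+ 2.
    by rewrite !exprMn -mulrDr cos2Dsin2 mulr1.
  by rewrite (E r' b') (E r b) -uE -vE -uE' -vE'.
rewrite rr in uE' vE'.
exists m, r, b, (b' - b); rewrite subrKC -uE -vE -uE' -vE'; split => //.
move: cross; apply: contra => /eqP; rewrite sinB => sE.
have -> : u * v' - v * u' = r ^+ 2 * (sin b' * cos b - cos b' * sin b) by rewrite uE vE uE' vE';
  ring.
by rewrite sE mulr0.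
Qed.

Lemma rotation_vec2 (R : realType) (l th : R) (p : plane R) (r b : R) (s : R) :
  rotation th (scaling l (p + vec2 (s * (r * cos b)) (s * (r * sin b)))) =
  rotation th (scaling l p) + vec2 (s * (l * r * cos (th + b))) (s * (l * r * sin (th + b))).
Proof.
apply/rowP => j; rewrite !mxE /=; case: ifP => _; rewrite ?sinD ?cosD; ring.
Qed.

Theorem theorem2 (R : realType) (gamma : set (plane R)) (Q : quadrilateral R)
    (hgamma : closed_convex_curve gamma) (hQ : rectangle Q) :
  exists phi : plane R -> plane R, inscribed_by phi Q gamma.
Proof.
have [z [m' [M [g [G on_gamma]]]]] := closed_convex_curve_gauge hgamma.
have [m [r [b [al [r0 sal Q0 Q2 [Q1 Q3]]]]]] := rectangle_diagonals hQ.
have [t [c1 [c2 [a [a0 _ [hP hL] [hT hB]]]]]] := inscribed_gauge G sal.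
(* [t - b] and [a / r] align the diagonals in direction and length, and [T] brings the center [m] of
   [Q] to the center of the inscribed rectangle. *)
pose T := z + vec2 c1 c2 - rotation (t - b) (scaling (a / r) m).
exists (translation T \o rotation (t - b) \o scaling (a / r)); split.
  by exists (a / r), (t - b), T; split=> //; rewrite divr_gt0.
have vertex s c : g (c1 + s * (a * cos (t - b + c))) (c2 + s * (a * sin (t - b + c))) = 1 ->
    gamma ((translation T \o rotation (t - b) \o scaling (a / r))
      (m + vec2 (s * (r * cos c)) (s * (r * sin c)))).
  move=> /on_gamma; congr gamma; rewrite /= rotation_vec2 /translation /T divfK ?gt_eqF //.
  by apply/rowP => j; rewrite !mxE; case: ifP => _; ring.
have vecN x y : - vec2 x y = vec2 (-1 * x) (-1 * y) :> plane R.
  by apply/rowP => j; rewrite !mxE; case: ifP => _; ring.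
have vec1 x y : vec2 x y = vec2 (1 * x) (1 * y) :> plane R by rewrite !mul1r.
have E1 : t - b + b = t by rewrite subrK.
have E2 : t - b + (b + al) = t + al by ring.
case=> [[|[|[|[|//]]]] hi].
- have -> : Ordinal hi = 0 by apply/val_inj.
  by rewrite Q0 vec1; apply: vertex; rewrite !mul1r E1.
- have -> : Ordinal hi = 1 by apply/val_inj.
  by rewrite Q1 vec1; apply: vertex; rewrite !mul1r E2.
- have -> : Ordinal hi = 2 by apply/val_inj.
  by rewrite Q2 vecN; apply: vertex; rewrite !mulN1r E1.
- have -> : Ordinal hi = 3 by apply/val_inj.
  by rewrite Q3 vecN; apply: vertex; rewrite !mulN1r E2.
Qed.
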